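(* Let $T$ be an $n$-sufficiently subdivided finite tree with at least one essential vertex, $n\ge2$. Then the vertex set of $G(n,T)$ consists of the $n!$ critical $0$-cells, which are exactly the permutations of $(0,1,\dots,n-1)$, identified with $\mathcal S_n$ as in the context, and the edge set of $G(n,T)$ decomposes as a disjoint union $E(G(n,T))=\bigsqcup_{2\le j\le i\le n}E_{i,j}$, where for each such $i,j$ and each $\tau\in\mathcal S_n$ the set $E_{i,j}$ contains exactly $$\sum_{\ell=2}^{i}\binom{i-2}{\ell-2}m_\ell$$ edges oriented from $\tau$ to $\sigma_{i,j}^{-1}\circ\tau$, and these are all the edges of $E_{i,j}$. Here $\sigma_{i,j}\in\mathcal S_n$ is the cycle $n-i+1\mapsto n-i+2\mapsto\cdots\mapsto n-i+j\mapsto n-i+1$. Moreover, each $E_{i,j}$ is $\mathcal S_n$-invariant, and $\mu\in\mathcal S_n$ takes each oriented edge of $E_{i,j}$ from $\tau$ to $\sigma_{i,j}^{-1}\circ\tau$ homeomorphically onto an oriented edge of $E_{i,j}$ from $\tau\circ\mu$ to $\sigma_{i,j}^{-1}\circ\tau\circ\mu$.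
   Context: A tree $T$ is $n$-sufficiently subdivided if every path between distinct vertices of degree $\neq2$ passes through at least $n-1$ edges; an essential vertex has degree $\ge3$; $m_r=\sum_v\binom{d(v)-1}{r}$ over vertices $v$ with degree $d(v)>r$. The discretized configuration space $\mathcal D^nT$ is the subcomplex of the product cell complex $T^n$ of cells $(a_1,\dots,a_n)$ with pairwise disjoint closures; $\mathcal S_n$ acts by $(a_1,\dots,a_n)\cdot\sigma=(a_{\sigma(1)},\dots,a_{\sigma(n)})$. Fix a root vertex $0$ of degree one. For vertices $u,v$, $u\wedge v$ is the vertex $w$ with $[0,u]\cap[0,v]=[0,w]$ (paths in $T$). For $v\neq0$ number the edges at $v$ by $0,\dots,d(v)-1$, with $0$ for the edge towards $0$; the edge at $0$ gets number $1$. For $v\ne w$, $g(v,w)$ is the number of the edge at $v$ on the path from $v$ to $w$. Order vertices: for $u\neq v$, $w=u\wedge v$, $u<v$ iff $u=w$ or ($u\ne w$ and $g(w,u)<g(w,v)$); identify vertices with $0,1,2,\dots$ in this order. For $v\ne0$, $e(v)$ is the edge at $v$ towards $0$; edges are written $(x,y)$ with $x<y$. In a cell $a$, a vertex coordinate $a_i$ is blocked if $a_i=0$ or the closure of $e(a_i)$ meets the closure of another coordinate; otherwise $\mathrm{er}_i(a)$ replaces $a_i$ by $e(a_i)$, and $\mathrm{pr}(a)=\mathrm{er}_i(a)$ for the smallest unblocked vertex $a_i$. $W=\bigcup_kW_k$ where $W_0=\{(a,\mathrm{pr}(a)): a$ a $0$-cell, $\mathrm{pr}(a)$ defined$\}$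 and $W_{k+1}=\{(a,\mathrm{pr}(a)): a$ a $(k+1)$-cell, $\mathrm{pr}(a)$ defined, $a$ not a second entry of a pair in $W_k\}$; $W$ is a discrete gradient vector field (no closed gradient paths). A cell is critical if it is in no pair of $W$. For a $0$-cell $u$ define $\varphi(u)=u$ if $u$ is critical; otherwise $(u,W(u))\in W$ with $W(u)$ a $1$-cell with endpoints $u,u'$, and $\varphi(u)=\varphi(u')$ (this terminates). The directed multigraph $G(n,T)$ has as vertices the critical $0$-cells of $\mathcal D^nT$ and one edge for each critical $1$-cell $c$: $c$ has exactly one edge coordinate $(x,y)$, $x<y$; letting $c_x,c_y$ be the $0$-cells obtained by replacing it by $x$, resp. $y$, the edge goes from $\varphi(c_x)$ to $\varphi(c_y)$. $G(n,T)$ is homotopy equivalent to the complex obtained from the $1$-skeleton of $\mathcal D^nT$ by deleting redundant $1$-cells and collapsing collapsible ones, and inherits an $\mathcal S_n$-action. A critical $0$-cell $(a_1,\dots,a_n)$ with $\{a_1,\dots,a_n\}=\{0,\dots,n-1\}$ is identified with $\tau\in\mathcal S_n$, $\tau(i)=a_i+1$; then the action is right composition, $\tau\cdot\mu=\tau\circ\mu$. *)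

(* Defs.v *)
From mathcomp Require Import all_boot all_fingroup.
Set Implicit Arguments. Unset Strict Implicit. Unset Printing Implicit Defensive.

Section TreeDefs.
Variables (V : finType) (adj : rel V).

Definition deg (v : V) : nat := #|[set x | adj v x]|.

Definition tedges : {set {set V}} :=
  [set e : {set V} | [exists x, exists y, adj x y && (e == [set x; y])]].

Definition is_tree : Prop :=
  symmetric adj /\ irreflexive adj /\ (forall x y, connect adj x y) /\
  #|tedges| = #|V|.-1.

Definition vpath (x y : V) : {set V} :=
  [set z | [exists k : 'I_#|V|, exists t : k.-tuple V,
     [&& path adj x t, last x t == y, uniq (x :: t) & z \in x :: t]]].

Definition suff_subdivided (n : nat) : Prop :=
  forall (u v : V) (p : seq V), u != v -> deg u != 2 -> deg v != 2 ->
    path adj u p -> last u p = v -> uniq (u :: p) -> n.-1 <= size p.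

Definition essential (v : V) : bool := 2 < deg v.

Definition mnum (k : nat) : nat := \sum_(v : V | k < deg v) 'C(deg v - 1, k).

Variable (r : V). (* the root vertex "0" *)

Definition step (x y : V) : V := odflt x [pick z | adj x z && (z \in vpath x y)].

Definition meet (u v : V) : V :=
  odflt r [pick w | (vpath r u :&: vpath r v) == vpath r w].

Variable (num : V -> V -> nat). (* num v x = number of edge {v,x} at v *)

Definition numbering_ok : Prop :=
  (forall v, v != r -> {in [set x | adj v x] &, injective (num v)}) /\
  (forall v x, v != r -> adj v x -> num v x < deg v) /\
  (forall v x, v != r -> adj v x -> x \in vpath v r -> num v x = 0) /\
  (forall x, adj r x -> num r x = 1).

Definition gnum (v w : V) : nat := num v (step v w).

Definition vlt (u v : V) : bool :=
  (u != v) &&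
  (let w := meet u v in
   (u == w) || [&& u != w, v != w & gnum w u < gnum w v]).

Definition rank (v : V) : nat := #|[set x | vlt x v]|.

Definition eup (v : V) : {set V} := [set v; step v r].

(* Cells. A cell of T is represented by its set of vertices: a vertex v  *)
(* is [set v], an edge is [set x; y] with adj x y. For cells of a graph,  *)
(* closures are disjoint iff these vertex sets are disjoint.             *)
Definition tcell (c : {set V}) : bool :=
  (#|c| == 1) || (c \in tedges).

Definition vtx (c : {set V}) : V := odflt r [pick x in c].

Variable (n : nat).

Definition ncell := {ffun 'I_n -> {set V}}.

Definition inD (a : ncell) : bool :=
  [forall i, tcell (a i)] &&
  [forall i, forall j, (i != j) ==> [disjoint a i & a j]].

Definition dim (a : ncell) : nat := #|[set i | #|a i| == 2]|.

Definition blocked (a : ncell) (i : 'I_n) : bool :=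
  (a i == [set r]) ||
  [exists j, (j != i) && ~~ [disjoint eup (vtx (a i)) & a j]].

Definition unblocked (a : ncell) (i : 'I_n) : bool :=
  (#|a i| == 1) && ~~ blocked a i.

Definition er (a : ncell) (i : 'I_n) : ncell :=
  [ffun k => if k == i then eup (vtx (a i)) else a k].

Definition pr (a : ncell) : option ncell :=
  match [pick i | unblocked a i &&
           [forall j, unblocked a j ==> (rank (vtx (a i)) <= rank (vtx (a j)))]]
  with Some i => Some (er a i) | None => None end.

(* Wfirst k a : (a, pr a) \in W_k *)
Fixpoint Wfirst (k : nat) (a : ncell) : bool :=
  [&& inD a, dim a == k, pr a != None &
   match k with
   | 0 => true
   | k'.+1 => ~~ [exists b, Wfirst k' b && (pr b == Some a)]
   end].

Definition inW1 (a : ncell) : bool := Wfirst (dim a) a.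
Definition inW2 (a : ncell) : bool := [exists b, inW1 b && (pr b == Some a)].

Definition critical (a : ncell) : bool := [&& inD a, ~~ inW1 a & ~~ inW2 a].

(* one step of the flow on 0-cells: u |-> u' where W(u) has endpoints u,u' *)
Definition flowstep (a : ncell) : ncell :=
  if critical a then a else
  match pr a with
  | Some b => [ffun k => if a k == b k then a k else b k :\: a k]
  | None => a
  end.

(* phi(u): iterate until a critical 0-cell is reached (any terminating
   gradient path has at most #|ncell| steps, and critical cells are fixed) *)
Definition phi (a : ncell) : ncell := iter #|{: ncell}| flowstep a.

Definition ecoord (c : ncell) : option 'I_n := [pick i | #|c i| == 2].

Definition lo_end (e : {set V}) : V :=
  odflt r [pick x in e | [forall y in e, (y != x) ==> vlt x y]].
Definition hi_end (e : {set V}) : V :=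
  odflt r [pick y in e | [forall x in e, (x != y) ==> vlt x y]].

Definition replace_by (c : ncell) (f : {set V} -> V) : ncell :=
  match ecoord c with
  | Some i => [ffun k => if k == i then [set f (c i)] else c k]
  | None => c
  end.

Definition gsrc (c : ncell) : ncell := phi (replace_by c lo_end).
Definition gtgt (c : ncell) : ncell := phi (replace_by c hi_end).

(* critical 0-cells and 1-cells: vertices and edges of G(n,T) *)
Definition crit0 (a : ncell) : bool := critical a && (dim a == 0).
Definition crit1 (a : ncell) : bool := critical a && (dim a == 1).

(* identification of a critical 0-cell with a permutation, 0-based:
   tau_of a k = a_k (= tau(k+1) - 1 in the paper's 1-based notation) *)
Definition tau_of (a : ncell) (k : 'I_n) : nat := rank (vtx (a k)).

Definition cact (a : ncell) (s : 'S_n) : ncell := [ffun k => a (s k)].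

End TreeDefs.

(* sigma_{i,j} on 0-based values: n-i -> n-i+1 -> ... -> n-i+j-1 -> n-i
   (the paper's cycle n-i+1 -> ... -> n-i+j -> n-i+1 shifted down by 1) *)
Definition cycnat (n i j v : nat) : nat :=
  if (n - i <= v) && (v < n - i + j - 1) then v.+1
  else if v == n - i + j - 1 then n - i else v.

(* Main.v *)
Require Import Defs.
From mathcomp Require Import all_boot all_fingroup.
From mathcomp Require Import zify.

(** Rooting T at r turns it into a parent map, and the vertex order into the depth-first
preorder.  A vertex coordinate of a cell is unblocked iff its parent is not occupied, so the
critical 0-cells are those whose occupied vertices are closed under parents; by the
subdivision hypothesis these are the first n vertices of the trunk below the first branching.
The gradient flow moves the lowest unblocked particle one step down and preserves the linear
order of the particles.  Hence the endpoints of the edge of G(n,T) given by a critical 1-cell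
can be read off by sorting the two ends of that cell, without following the flow.

In a critical 1-cell the edge coordinate hangs at an essential vertex x, n - i particles sit
on the trunk and i - 1 particles fill initial segments of the branches of x.  Moving the edge
particle from x to the other end lets it jump over the j - 1 particles on lower branches,
which gives the cycle sigma_(i,j).  For a fixed source such cells at x correspond to weakly
increasing sequences of i branch numbers with a strict increase at j, so there are
C(d(x) + i - 3, i) of them, and Vandermonde's identity gives the stated sum. *)

Set Implicit Arguments. Unset Strict Implicit. Unset Printing Implicit Defensive.

(** * The parent map of a rooted tree *)

(** The flow can be bypassed because of two facts. When the lowest unblocked particle steps down, no
    occupied vertex lies between its old and its new place in the vertex order, so the order of the
    particles never changes. And a cell without unblocked particles occupies exactly the ranks 0,
    ..., n - 1, so there the rank of a particle is its position in that order.

    The delicate point is the amount of room above an essential vertex x. Up to n particles may sit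
    there, while subdivision guarantees an unbranched line of only n - 1 vertices in each branch.
    The edge particle always starts a new branch, with at least one particle before it, so no branch
    receives more than i - 1 particles. This is why the depth bounds below carry the correction term
    [(s < j.-1)].

    Counting all edges with source tau is reduced, by the action, to cells whose target is the
    identity: there the index of a particle is its position, so the cell is determined by x and the
    branch numbers of its i local particles. *)

Section Tree.
Variables (V : finType) (adj : rel V) (r : V).
Hypothesis treeT : is_tree adj.

Let adj_sym : symmetric adj. Proof. by case: treeT. Qed.
Let adj_irr : irreflexive adj. Proof. by case: treeT => _ []. Qed.
Let adj_conn x y : connect adj x y. Proof. by case: treeT => _ [_ []]. Qed.
Let card_tedges : #|tedges adj| = #|V|.-1. Proof. by case: treeT => _ [_ []]. Qed.

Fixpoint reach (k : nat) (v : V) : bool :=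
  if k is k'.+1 then [exists u, reach k' u && adj u v] else v == r.

Lemma reach_ex v : exists k, reach k v.
Proof.
have /connectP [p] := adj_conn r v.
elim/last_ind: p v => [|p u IH] v /=; first by move=> _ ->; exists 0 => /=.
rewrite rcons_path last_rcons => /andP [pp auv] ->.
have [k kr] := IH _ pp erefl; exists k.+1 => /=.
by apply/existsP; exists (last r p); rewrite kr.
Qed.

Definition depth (v : V) : nat := ex_minn (reach_ex v).

Lemma depth_root : depth r = 0.
Proof. by rewrite /depth; case: ex_minnP => m _ /(_ 0 (eqxx r)); rewrite leqn0 => /eqP. Qed.

Lemma depth_eq0 v : (depth v == 0) = (v == r).
Proof.
apply/eqP/eqP => [|->]; last exact: depth_root.
by rewrite /depth; case: ex_minnP => m rm _ m0; move: rm; rewrite m0 => /eqP.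
Qed.

Lemma depth_adj u v : adj u v -> depth v <= (depth u).+1.
Proof.
move=> auv; rewrite {1}/depth; case: ex_minnP => m _; apply => /=.
apply/existsP; exists u; rewrite auv andbT /depth.
by case: ex_minnP.
Qed.

Lemma parent_ex v : v != r -> exists u, adj u v && ((depth u).+1 == depth v).
Proof.
rewrite -depth_eq0 => dv; have: reach (depth v) v by rewrite /depth; case: ex_minnP.
case E: (depth v) dv => [//|k] _ /= /existsP [u /andP [ru auv]].
exists u; rewrite auv /= eqn_leq; apply/andP; split; last by have := depth_adj auv; rewrite E.
by rewrite ltnS /depth; case: ex_minnP => m _; apply.
Qed.

(** At the root no neighbour qualifies, so the default makes [r] its own parent and all iterates of
    [parent] are meaningful. *)
Definition parent (v : V) : V := odflt r [pick u | adj u v && ((depth u).+1 == depth v)].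

Lemma parent_root : parent r = r.
Proof. by rewrite /parent; case: pickP => // u; rewrite depth_root andbF. Qed.

Lemma parentP v : v != r -> adj (parent v) v /\ (depth (parent v)).+1 = depth v.
Proof.
move=> vr; rewrite /parent; case: pickP => [u /andP [-> /eqP ->]//|h].
by have [u] := parent_ex vr; rewrite h.
Qed.

Lemma depth_parent v : depth (parent v) = (depth v).-1.
Proof.
by have [->|/parentP [_ <-]//] := eqVneq v r; rewrite parent_root depth_root.
Qed.

Lemma parent_neq v : v != r -> parent v != v.
Proof. by move=> /parentP [_ h]; apply: contra_eq_neq h => ->; rewrite -[X in _ != X]addn0 -addn1 eqn_add2l. Qed.

Lemma parent_edge_inj : {in [set~ r] &, injective (fun v => [set v; parent v])}.
Proof.
move=> u v; rewrite !in_setC1 => ur vr e.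
have [_ du] := parentP ur; have [_ dv] := parentP vr.
have: u \in [set v; parent v] by rewrite -e set21.
have: v \in [set u; parent u] by rewrite e set21.
rewrite !in_set2 => /orP [/eqP -> //|/eqP vE] /orP [/eqP -> //|/eqP uE].
by move: du dv; rewrite -uE -vE; lia.
Qed.

(** The edges to parents are pairwise distinct and already number [#|V|.-1], so the edge count in
    [is_tree] leaves no other edge. This is how acyclicity enters. *)
Lemma tedgesE : tedges adj = [set [set v; parent v] | v in [set~ r]].
Proof.
apply/esym/eqP; rewrite eqEcard; apply/andP; split.
  apply/subsetP => e /imsetP [v]; rewrite in_setC1 => vr ->.
  rewrite inE; apply/existsP; exists v; apply/existsP; exists (parent v).
  by rewrite eqxx andbT adj_sym; case: (parentP vr).
by rewrite card_tedges (card_in_imset parent_edge_inj) cardsC1.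
Qed.

Lemma adjE u v : adj u v = (u != r) && (v == parent u) || (v != r) && (u == parent v).
Proof.
apply/idP/orP => [auv|[/andP [ur /eqP ->]|/andP [vr /eqP ->]]].
- have: [set u; v] \in tedges adj.
    rewrite inE; apply/existsP; exists u; apply/existsP; exists v.
    by rewrite auv eqxx.
  rewrite tedgesE => /imsetP [w]; rewrite in_setC1 => wr e.
  have uv : u != v by apply: contraTneq auv => ->; rewrite adj_irr.
  have: u \in [set w; parent w] by rewrite -e set21.
  have: v \in [set w; parent w] by rewrite -e set22.
  rewrite !in_set2 => /orP [/eqP vE|/eqP vE] /orP [/eqP uE|/eqP uE].
  + by rewrite uE vE eqxx in uv.
  + by right; rewrite vE uE wr eqxx.
  + by left; rewrite vE uE wr eqxx.
  + by rewrite uE vE eqxx in uv.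
- by rewrite adj_sym; case: (parentP ur).
- by case: (parentP vr).
Qed.

Lemma adj_parent v : v != r -> adj v (parent v).
Proof. by move=> vr; rewrite adjE vr eqxx. Qed.

Lemma depth_iter k v : depth (iter k parent v) = depth v - k.
Proof. by elim: k => [|k IH] /=; rewrite ?subn0 // depth_parent IH; lia. Qed.

(** Each parent step lowers the depth by one, so the difference of depths is the only number of
    steps that has to be tested. *)
Definition anc (u v : V) : bool := iter (depth v - depth u) parent v == u.

Lemma anc_iter k v : anc (iter k parent v) v.
Proof.
have [kv|vk] := leqP k (depth v); first by rewrite /anc depth_iter subKn.
have rE m : depth v <= m -> iter m parent v = r.
  by move=> vm; apply/eqP; rewrite -depth_eq0 depth_iter subn_eq0.
by rewrite (rE k) ?(ltnW vk) // /anc depth_root subn0 rE.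
Qed.

Lemma ancP u v : reflect (exists k, iter k parent v = u) (anc u v).
Proof.
by apply: (iffP eqP) => [<-|[k <-]]; [eexists | apply/eqP/anc_iter].
Qed.

Lemma ancxx v : anc v v. Proof. by apply/ancP; exists 0. Qed.
Lemma anc_root v : anc r v.
Proof. by rewrite /anc depth_root subn0 -depth_eq0 depth_iter subnn. Qed.
Lemma anc_parent v : anc (parent v) v. Proof. exact: (anc_iter 1). Qed.

Lemma anc_trans v u w : anc u v -> anc v w -> anc u w.
Proof.
by move=> /ancP [k <-] /ancP [l <-]; apply/ancP; exists (k + l); rewrite iterD.
Qed.

Lemma anc_depth u v : anc u v -> depth u <= depth v.
Proof. by move=> /ancP [k <-]; rewrite depth_iter leq_subr. Qed.

Lemma anc_depth_eq u v : anc u v -> depth v <= depth u -> u = v.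
Proof. by rewrite /anc => /eqP e; rewrite -subn_eq0 => /eqP h; rewrite -e h. Qed.

Lemma anc_anti u v : anc u v -> anc v u -> u = v.
Proof. by move=> /anc_depth_eq h /anc_depth. Qed.

Lemma anc_ltn u v : anc u v -> u != v -> depth u < depth v.
Proof. by move=> a; apply: contraNT; rewrite -leqNgt => /(anc_depth_eq a) ->. Qed.

Lemma anc_parentr u v : anc u v -> u != v -> anc u (parent v).
Proof.
move=> /ancP [[|k] <-]; first by rewrite /= eqxx.
by move=> _; rewrite iterSr anc_iter.
Qed.

Lemma anc_linear u w v : anc u v -> anc w v -> depth u <= depth w -> anc u w.
Proof.
move=> /eqP <- /eqP <-; set a := depth v - _; set b := depth v - _ => h.
have [ba|ab] := leqP b a; first by apply/ancP; exists (a - b); rewrite -iterD subnK.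
rewrite [X in anc X _](_ : _ = iter b parent v) ?ancxx //.
apply/esym/anc_depth_eq => //; apply/ancP.
by exists (b - a); rewrite -iterD subnK // ltnW.
Qed.

Lemma anc_parent_self v : v != r -> ~~ anc v (parent v).
Proof.
move=> vr; apply: contra (parent_neq vr) => h.
by rewrite -(anc_anti h (anc_parent v)).
Qed.

Lemma lca_ex u v : exists w, [/\ anc w u, anc w v & forall z, anc z u -> anc z v -> anc z w].
Proof.
have h : exists k, (k <= depth u) && anc (iter (depth u - k) parent u) v.
  by exists 0; have := eqP (anc_root u); rewrite depth_root => ->; exact: anc_root.
have hb k : (k <= depth u) && anc (iter (depth u - k) parent u) v -> k <= depth u.
  by case/andP.
case: (ex_maxnP h hb) => k /andP [ku kv] kmax.
exists (iter (depth u - k) parent u); split => //; first exact: anc_iter.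
move=> z zu zv; apply: (anc_linear zu); first exact: anc_iter.
rewrite depth_iter subKn //; apply: kmax.
by rewrite (eqP zu) zv anc_depth.
Qed.

(* A simple path that steps down from [parent c] to [c] cannot turn back up. *)
Lemma path_down c t : c != r -> path adj c t -> uniq (c :: t) ->
  parent c \notin t -> anc c (last c t).
Proof.
elim: t c => [|d t IH] c cr /=; first by move=> _ _ _; exact: ancxx.
rewrite adjE cr /= => /andP [/orP [/eqP ->|/andP [dr /eqP cE]]].
  by move=> _ _; rewrite inE eqxx.
move=> pt /andP [ct ut] _; rewrite {1}cE; apply: anc_trans (anc_parent d) _.
apply: IH => //; rewrite -cE; apply: contra ct; rewrite inE => ->; exact: orbT.
Qed.

(** A simple path that ever stepped away from the root would stay in that subtree by [path_down] and
    could not reach [w]. So every step goes to the parent. *)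
Lemma path_up w u t : anc w u -> path adj u t -> last u t = w -> uniq (u :: t) ->
  t = traject parent (parent u) (depth u - depth w).
Proof.
elim: t u => [|c t IH] u wu /=; first by move=> _ -> _; rewrite subnn.
move=> /andP [uc pt] lt /andP [ut uniqt].
have nuw : w != u by apply: contraNneq ut => <-; rewrite -lt mem_last.
have du := anc_ltn wu nuw.
move: uc; rewrite adjE => /orP [/andP [ur /eqP cE]|/andP [cr /eqP uE]]; last first.
  have := path_down cr pt uniqt.
  rewrite -uE lt => h.
  have /h : u \notin t by apply: contra ut; rewrite inE => ->; rewrite orbT.
  move=> /anc_depth; have [_] := parentP cr; rewrite -uE; lia.
rewrite (_ : depth u - depth w = (depth c - depth w).+1); last first.
  by rewrite cE depth_parent; lia.
rewrite /= -cE; congr (_ :: _).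
by apply: IH => //; rewrite cE; apply: anc_parentr.
Qed.

Lemma path_traject v k : k <= depth v -> path adj v (traject parent (parent v) k).
Proof.
elim: k v => [//|k IH] v kv /=; rewrite adj_parent ?IH ?depth_parent //; first lia.
by rewrite -depth_eq0; lia.
Qed.

Lemma uniq_traject v k : k <= depth v -> uniq (traject parent v k.+1).
Proof.
elim: k v => [//|k IH] v kv; rewrite [traject]lock /= -lock trajectS cons_uniq IH ?depth_parent; last lia.
rewrite andbT; apply/trajectP => -[m _ h].
have := congr1 depth h; rewrite -iterSr depth_iter; lia.
Qed.

Lemma mem_vpath_anc w u z : anc w u -> (z \in vpath adj u w) = anc w z && anc z u.
Proof.
move=> wu; have dw := anc_depth wu; rewrite inE; apply/existsP/andP.
  move=> [k /existsP [t /and4P [pt /eqP lt ut zt]]].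
  have tE := path_up wu pt lt ut.
  move: zt; rewrite tE -trajectS => /trajectP [m].
  rewrite ltnS => mk ->; split; last exact: anc_iter.
  by apply: (anc_linear wu); rewrite ?anc_iter // depth_iter; lia.
move=> [wz zu].
have ud := @uniq_traject u (depth u - depth w) (leq_subr _ _).
have kV : depth u - depth w < #|V|.
  by rewrite -(size_traject parent u (depth u - depth w).+1) -(card_uniqP ud) max_card.
exists (Ordinal kV); apply/existsP.
have st : size (traject parent (parent u) (depth u - depth w)) == Ordinal kV.
  by rewrite size_traject.
exists (Tuple st); rewrite -trajectS ud path_traject ?leq_subr //= last_traject.
rewrite -/(anc w u) wu -trajectS; apply/trajectP; exists (depth u - depth z).
  by rewrite ltnS leq_sub2l // anc_depth.
by rewrite (eqP zu).
Qed.

Lemma vpath_sub x y : vpath adj x y \subset vpath adj y x.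
Proof.
apply/subsetP => z; rewrite !inE => /existsP [k /existsP [t /and4P [pt /eqP lt ut zt]]].
have E : y :: rev (belast x t) = rev (x :: t) by rewrite -lt -rev_rcons -lastI.
apply/existsP; exists k; apply/existsP.
have st : size (rev (belast x t)) == k by rewrite size_rev size_belast size_tuple.
exists (Tuple st); rewrite (_ : tval (Tuple st) = rev (belast x t)) // E rev_uniq ut mem_rev zt !andbT -lt rev_path.
rewrite (eq_path (e' := adj)) ?pt //=.
have -> : last (last x t) (rev (belast x t)) = last x (y :: rev (belast x t)).
  by rewrite /= lt.
by rewrite E rev_cons last_rcons.
Qed.

Lemma vpathC x y : vpath adj x y = vpath adj y x.
Proof. by apply/eqP; rewrite eqEsubset !vpath_sub. Qed.

Lemma step_root v : step adj v r = parent v.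
Proof.
rewrite /step; case: pickP => [z|h] /=.
  rewrite mem_vpath_anc ?anc_root //= adjE => /andP [/orP [/andP [vr /eqP ->]//|]].
  move=> /andP [zr /eqP ->] zv; by move: (anc_parent_self zr); rewrite zv.
have [->|vr] := eqVneq v r; first by rewrite parent_root.
have := h (parent v).
by rewrite mem_vpath_anc ?anc_root // adj_parent // anc_parent.
Qed.

Lemma step_down w c u : c != r -> parent c = w -> anc c u -> step adj w u = c.
Proof.
move=> cr cw cu.
have wu : anc w u by rewrite -cw; apply: anc_trans (anc_parent c) cu.
rewrite /step; case: pickP => [z|/(_ c)] /=.
  rewrite vpathC mem_vpath_anc // adjE => /and3P [/orP [/andP [wr /eqP ->]|/andP [zr /eqP wE]] wz zu].
    by move: (anc_parent_self wr); rewrite wz.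
  have [_ dz] := parentP zr; have [_ dc] := parentP cr.
  apply: anc_depth_eq; last by rewrite -dz -dc -wE cw.
  by apply: (anc_linear zu cu); rewrite -dz -dc -wE cw.
by rewrite vpathC mem_vpath_anc // cu adjE cw eqxx cr /= -cw anc_parent orbT.
Qed.

Lemma meetP u v w : anc w u -> anc w v -> (forall z, anc z u -> anc z v -> anc z w) ->
  meet adj r u v = w.
Proof.
move=> wu wv wmax.
have pE x z : (z \in vpath adj r x) = anc z x by rewrite vpathC mem_vpath_anc ?anc_root.
rewrite /meet; case: pickP => [z /eqP/setP h|/(_ w)] /=.
  have hz y : anc y u && anc y v = anc y z by rewrite -!pE -h in_setI.
  have /andP [zu zv] : anc z u && anc z v by rewrite hz ancxx.
  by apply: anc_anti; [apply: wmax | rewrite -hz wu].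
move=> /eqP; case; apply/setP => z; rewrite in_setI !pE.
by apply/andP/idP => [[]|zw]; [apply: wmax | split; apply: anc_trans zw _].
Qed.

(** * The depth-first order *)

Variable num : V -> V -> nat.
Hypothesis numb : numbering_ok adj r num.
Hypothesis degr : deg adj r = 1.

Definition child (v c : V) : bool := (c != r) && (parent c == v).

Lemma childP v c : reflect (c != r /\ parent c = v) (child v c).
Proof. by apply: (iffP andP) => -[? /eqP]. Qed.

Lemma child_adj v c : child v c -> adj v c.
Proof. by move=> /childP [cr <-]; rewrite adjE cr eqxx orbT. Qed.

Lemma child_anc v c : child v c -> anc v c.
Proof. by move=> /childP [_ <-]; exact: anc_parent. Qed.

Lemma child_depth v c : child v c -> depth c = (depth v).+1.
Proof. by move=> /childP [cr <-]; case: (parentP cr) => _ ->. Qed.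

Lemma child_ex u v : anc u v -> u != v -> exists2 c, child u c & anc c v.
Proof.
move=> uv nuv; have d := anc_ltn uv nuv.
exists (iter (depth v - depth u).-1 parent v); last exact: anc_iter.
rewrite /child -iterS prednK ?subn_gt0 //.
by apply/andP; split; [rewrite -depth_eq0 depth_iter; lia | exact: uv].
Qed.

(** [numbering_ok] asserts injectivity only away from the root; at the root, degree one takes its
    place. *)
Lemma child_root_uniq c c' : child r c -> child r c' -> c = c'.
Proof.
move: degr => /eqP/cards1P [x xE] /child_adj h /child_adj h'.
have : c \in [set x] by rewrite -xE inE.
have : c' \in [set x] by rewrite -xE inE.
by rewrite !inE => /eqP -> /eqP ->.
Qed.

Lemma num_inj v c c' : child v c -> child v c' -> num v c = num v c' -> c = c'.
Proof.
case: numb => [inj _] h h' e.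
have [vr|vr] := eqVneq v r; first by apply: child_root_uniq; rewrite -vr.
by apply: inj vr _ _ _ _ e; rewrite inE child_adj.
Qed.

Lemma neighborsE v : v != r -> [set x | adj v x] = parent v |: [set c | child v c].
Proof.
move=> vr; apply/setP => x; rewrite !inE adjE vr /child.
by rewrite [v == _]eq_sym.
Qed.

Lemma parent_not_child v : ~~ child v (parent v).
Proof. by apply/negP => /child_depth; rewrite depth_parent; lia. Qed.

Lemma deg_children v : v != r -> deg adj v = #|[set c | child v c]|.+1.
Proof.
by move=> vr; rewrite /deg neighborsE // cardsU1 inE (negbTE (parent_not_child v)).
Qed.

Lemma num_bounds v c : v != r -> child v c -> 0 < num v c < deg adj v.
Proof.
move=> vr vc; case: numb => inj [lt [z _]].
rewrite lt ?child_adj // andbT lt0n; apply/eqP => n0.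
have := z v (parent v) vr (adj_parent vr).
rewrite mem_vpath_anc ?anc_root ?anc_parent // => /(_ isT) pn0.
move: (parent_not_child v); rewrite (inj v vr (parent v) c) ?vc ?inE ?pn0 ?n0 //.
- exact: adj_parent.
- exact: child_adj.
Qed.

Lemma num_surj v b : v != r -> 0 < b < deg adj v -> exists2 c, child v c & num v c = b.
Proof.
move=> vr /andP [b0 bd]; have [m dE] : exists m, deg adj v = m.+2 by exists (deg adj v).-2; lia.
pose f (c : V) : 'I_m.+1 := inord (num v c).-1.
have fE c : child v c -> f c = (num v c).-1 :> nat.
  by move=> vc; rewrite inordK //; have := num_bounds vr vc; lia.
have finj : {in [set c | child v c] &, injective f}.
  move=> c c'; rewrite !inE => vc vc' /(congr1 val) /=; rewrite !fE // => e.
  by apply: (num_inj vc vc'); have := num_bounds vr vc; have := num_bounds vr vc'; lia.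
have : f @: [set c | child v c] = [set: 'I_m.+1].
  apply/eqP; rewrite eqEcard subsetT cardsT card_ord (card_in_imset finj).
  by move: dE; rewrite deg_children // => -[->] /=.
move=> /setP /(_ (inord b.-1)); rewrite inE => /imsetP [c]; rewrite inE => vc e.
exists c => //; have := congr1 val e; rewrite /= fE // inordK; last by lia.
by have := num_bounds vr vc; lia.
Qed.

Lemma deg2_child v : v != r -> deg adj v = 2 -> exists2 c, child v c & forall c', child v c' -> c' = c.
Proof.
move=> vr; rewrite deg_children // => -[/eqP/cards1P [c /setP cE]].
by exists c => [|c' vc']; [have := cE c | have := cE c']; rewrite !inE ?eqxx // vc' => /esym/eqP.
Qed.

Lemma deg_two_children v c c' : child v c -> child v c' -> c != c' -> v != r /\ 2 < deg adj v.
Proof.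
move=> vc vc' ncc'.
have vr : v != r by apply: contraNneq ncc' => vr; rewrite vr in vc vc'; apply/eqP/child_root_uniq.
split => //; rewrite deg_children // ltnS.
have <- : #|[set c; c']| = 2 by rewrite cards2 ncc'.
by apply/subset_leq_card/subsetP => z; rewrite !inE => /orP [] /eqP ->.
Qed.

(** * The vertex order as the lexicographic order on words of branch numbers *)

Fixpoint lex (s t : seq nat) : bool :=
  match s, t with
  | _, [::] => false
  | [::], _ => true
  | a :: s', b :: t' => (a < b) || (a == b) && lex s' t'
  end.

Lemma lex_irr s : lex s s = false.
Proof. by elim: s => //= a s ->; rewrite ltnn andbF. Qed.

Lemma lex_trans : transitive lex.
Proof.
elim=> [|b t IH] [|a s] [|c u] //=.
move=> /orP [ab|/andP [/eqP -> st]] /orP [bc|/andP [/eqP <- tu]]; apply/orP.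
- by left; apply: ltn_trans bc.
- by left.
- by left.
- by right; rewrite eqxx (IH _ _ st tu).
Qed.

Lemma lex_cat p s t : lex (p ++ s) (p ++ t) = lex s t.
Proof. by elim: p => //= a p ->; rewrite ltnn eqxx. Qed.

(** The branch numbers met on the way from the root to [v]. Ancestors have prefixes of this word,
    and [lex] puts proper prefixes first. *)
Definition key (v : V) : seq nat :=
  rev [seq num (parent z) z | z <- traject parent v (depth v)].

Lemma key_child v c : child v c -> key c = rcons (key v) (num v c).
Proof.
move=> vc; rewrite /key (child_depth vc) /= rev_cons.
by case/childP: vc => _ ->.
Qed.

Lemma key_anc w c u : child w c -> anc c u -> exists s, key u = key w ++ num w c :: s.
Proof.
move=> wc /ancP [k]; elim: k u => [|k IH] u.
  by move=> /= ->; exists [::]; rewrite (key_child wc) cats1.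
rewrite iterSr => e; have [s sE] := IH _ e.
have [ur|ur] := eqVneq u r; first by exists s; rewrite -sE ur parent_root.
have pu : child (parent u) u by apply/childP.
by exists (rcons s (num (parent u) u)); rewrite (key_child pu) sE rcons_cat.
Qed.

(** The words of [u] and [v] agree up to their meet. There one of them ends, or the next letters
    differ because siblings have different numbers. Transitivity, hard to see from [meet], becomes
    immediate. *)
Lemma vltE u v : vlt adj r num u v = lex (key u) (key v).
Proof.
rewrite /vlt; have [->|nuv] /= := eqVneq u v; first by rewrite lex_irr.
have [w [wu wv wmax]] := lca_ex u v; rewrite (meetP wu wv wmax).
have [uw|nuw] /= := eqVneq u w.
  rewrite -uw in wv; have [c uc cv] := child_ex wv nuv.
  have [s ->] := key_anc uc cv.
  by rewrite -[X in lex X]cats0 lex_cat.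
rewrite eq_sym in nuw.
have [c wc cu] := child_ex wu nuw; have [s ->] := key_anc wc cu.
have [->|nvw] /= := eqVneq v w.
  by rewrite -[X in lex _ X]cats0 lex_cat.
rewrite eq_sym in nvw.
have [d wd dv] := child_ex wv nvw; have [t ->] := key_anc wd dv.
have [[cr cw] [dr dw]] := (childP _ _ wc, childP _ _ wd).
rewrite lex_cat /= /gnum (step_down cr cw cu) (step_down dr dw dv).
have [e|//] := eqVneq (num w c) (num w d); last by rewrite orbF.
have cd := num_inj wc wd e; have := anc_depth (wmax c cu (eq_ind_r (anc^~ v) dv cd)).
by rewrite (child_depth wc) ltnn.
Qed.

(* Locked, because unfolding [vlt] in failing unifications is prohibitively slow. *)
Definition tlt : rel V := locked (vlt adj r num).
Definition rk : V -> nat := locked (rank adj r num).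

Notation "u <t v" := (tlt u v) (at level 70).

Lemma tltE u v : (u <t v) = lex (key u) (key v).
Proof. by rewrite /tlt -lock vltE. Qed.

Lemma vltxx u : (u <t u) = false.
Proof. by rewrite tltE lex_irr. Qed.

Lemma vlt_trans v u w : u <t v -> v <t w -> u <t w.
Proof. by rewrite !tltE; apply: lex_trans. Qed.

Lemma vlt_asym u v : u <t v -> v <t u -> False.
Proof. by move=> h /(vlt_trans h); rewrite vltxx. Qed.

Lemma vlt_branch w c d u v : child w c -> child w d -> num w c < num w d ->
  anc c u -> anc d v -> u <t v.
Proof.
move=> wc wd cd cu dv; rewrite tltE.
have [s ->] := key_anc wc cu; have [t ->] := key_anc wd dv.
by rewrite lex_cat /= cd.
Qed.

Lemma vlt_anc u v : anc u v -> u != v -> u <t v.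
Proof.
move=> uv nuv; have [c uc cv] := child_ex uv nuv.
by rewrite tltE; have [s ->] := key_anc uc cv; rewrite -[X in lex X]cats0 lex_cat.
Qed.

Lemma vlt_cases u v : [\/ anc u v, anc v u |
  exists w c d, [/\ child w c, child w d, num w c != num w d, anc c u & anc d v]].
Proof.
have [w [wu wv wmax]] := lca_ex u v.
have [<-|nwu] := eqVneq w u; first by apply: Or31.
have [<-|nwv] := eqVneq w v; first by apply: Or32.
have [c wc cu] := child_ex wu nwu; have [d wd dv] := child_ex wv nwv.
apply: Or33; exists w, c, d; split => //.
apply/eqP => e; have cd := num_inj wc wd e; rewrite -cd in dv.
by have := anc_depth (wmax c cu dv); rewrite (child_depth wc) ltnn.
Qed.

Lemma vlt_total u v : u != v -> (u <t v) || (v <t u).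
Proof.
move=> nuv; have [uv|vu|[w [c [d [wc wd]]]]] := vlt_cases u v.
- by rewrite vlt_anc.
- by rewrite (@vlt_anc v u) ?orbT // eq_sym.
rewrite neq_ltn => /orP [cd|dc] cu dv.
- by rewrite (vlt_branch wc wd).
- by rewrite (vlt_branch wd wc dc dv cu) orbT.
Qed.

(** If [u] were not above [z], it would be an ancestor of [z], or the two would separate at a
    branching whose numbers place [u] before [z] or after all vertices above [z]. *)
Lemma anc_convex z u v : anc z v -> z <t u -> u <t v -> anc z u.
Proof.
move=> zv zu uv; have [//|uz|[w [c [d [wc wd]]]]] := vlt_cases z u.
  have [<-|nuz] := eqVneq u z; first exact: ancxx.
  by case: (vlt_asym zu (vlt_anc uz nuz)).
rewrite neq_ltn => /orP [cd|dc] cz du.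
- by case: (vlt_asym uv); apply: vlt_branch wc wd cd _ du; apply: anc_trans zv.
- by case: (vlt_asym zu); apply: vlt_branch wd wc dc du cz.
Qed.

Lemma rankE v : rk v = #|[set x | x <t v]|.
Proof. by rewrite /rk /tlt -!lock. Qed.

Lemma rank_ltn u v : (rk u < rk v) = (u <t v).
Proof.
have h x y : x <t y -> rk x < rk y.
  move=> xy; rewrite !rankE; apply/proper_card/properP; split.
    by apply/subsetP => z; rewrite !in_set => zx; exact: vlt_trans zx xy.
  by exists x; rewrite in_set // vltxx.
apply/idP/idP; last exact: h.
have [->|/vlt_total/orP [//|/h]] := eqVneq u v; first by rewrite ltnn.
by move=> h1 /(ltn_trans h1); rewrite ltnn.
Qed.

Lemma rank_inj : injective rk.
Proof.
move=> u v e; apply/eqP; apply: contraT => /vlt_total.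
by rewrite -!rank_ltn e ltnn.
Qed.

(** * Sufficient subdivision *)

Variable n : nat.
Hypothesis n_gt1 : 1 < n.
Hypothesis subd : suff_subdivided adj n.
Hypothesis ess : exists v, essential adj v.

Lemma subdivided_anc x v : anc x v -> x != v -> deg adj x != 2 -> deg adj v != 2 ->
  n.-1 <= depth v - depth x.
Proof.
move=> xv nxv dx dv; rewrite eq_sym in nxv.
have := @subd v x (traject parent (parent v) (depth v - depth x)) nxv dv dx.
rewrite size_traject path_traject ?leq_subr // last_traject; apply => //.
- exact/eqP.
- exact: (@uniq_traject v (depth v - depth x) (leq_subr _ _)).
Qed.

Lemma essential_depth x : 2 < deg adj x -> n.-1 <= depth x.
Proof.
move=> dx; rewrite -[depth x]subn0 -depth_root; apply: subdivided_anc.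
- exact: anc_root.
- by apply: contraTneq dx => <-; rewrite degr.
- by rewrite degr.
- by move: dx; case: eqP => // ->.
Qed.

Lemma child_uniq_low v c c' : depth v < n.-1 -> child v c -> child v c' -> c = c'.
Proof.
move=> dv vc vc'; apply/eqP; apply: contraLR dv => ncc'.
by rewrite -leqNgt essential_depth //; case: (deg_two_children vc vc' ncc').
Qed.

Lemma child_uniq_above x v c c' : 2 < deg adj x -> anc x v -> x != v ->
  depth v - depth x < n.-1 -> child v c -> child v c' -> c = c'.
Proof.
move=> dx xv nxv dv vc vc'; apply/eqP; apply: contraLR dv => ncc'.
rewrite -leqNgt subdivided_anc //; first by move: dx; case: eqP => // ->.
by have [_] := deg_two_children vc vc' ncc'; case: eqP => // ->.
Qed.

Lemma child_ex_above x v : 2 < deg adj x -> anc x v -> x != v ->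
  depth v - depth x < n.-1 -> exists c, child v c.
Proof.
move=> dx xv nxv dv.
have vr : v != r by rewrite -depth_eq0; have := anc_ltn xv nxv; lia.
have [d2|d2] := eqVneq (deg adj v) 2.
  by have [c vc _] := deg2_child vr d2; exists c.
have := subdivided_anc xv nxv _ d2; rewrite leqNgt dv => /(_ _)/negP [] //.
by move: dx; case: eqP => // ->.
Qed.

(** Branching starts at depth [n.-1] at the earliest, so two vertices of equal depth up to there
    have the same parent by induction, and that parent has one child. *)
Lemma depth_inj_low u v : depth u = depth v -> depth v <= n.-1 -> u = v.
Proof.
move: {-1}(depth v) (erefl (depth v)) => k.
elim: k u v => [|k IH] u v dv du vn.
  have /eqP := dv; have /eqP := du; rewrite !depth_eq0.
  by move=> /eqP -> /eqP ->.
have pE : parent u = parent v by apply: IH; rewrite ?depth_parent ?du ?dv //; lia.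
have vr : v != r by rewrite -depth_eq0 dv.
have ur : u != r by rewrite -depth_eq0 du.
apply: (@child_uniq_low (parent v)); rewrite /child ?ur ?vr ?pE ?eqxx // depth_parent; lia.
Qed.

Lemma anc_low u v : depth u <= depth v -> depth u <= n.-1 -> anc u v.
Proof.
move=> uv un; rewrite (_ : u = iter (depth v - depth u) parent v) ?anc_iter //.
by apply: esym; apply: depth_inj_low un; rewrite depth_iter; lia.
Qed.

Lemma depth_ex m : m < n -> exists v, depth v = m.
Proof.
case: ess => x /essential_depth dx mn.
by exists (iter (depth x - m) parent x); rewrite depth_iter; lia.
Qed.

(** Any vertex at least as deep as [v] lies above [v] and hence does not precede it, so the
    predecessors of [v] are exactly its proper ancestors. *)
Lemma rank_low v : depth v < n -> rk v = depth v.
Proof.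
move: {2}(depth v) (erefl (depth v)) => k.
elim: k v => [|k IH] v dv dn.
  rewrite dv rankE; apply/eqP; rewrite cards_eq0; apply/eqP/setP => x; rewrite !inE.
  have /eqP := dv; rewrite depth_eq0 => /eqP ->; apply/negP => xr.
  have [e|nxr] := eqVneq r x; first by move: xr; rewrite -e vltxx.
  exact: (vlt_asym xr (vlt_anc (anc_root x) nxr)).
have vr : v != r by rewrite -depth_eq0 dv.
have npv := parent_neq vr.
have pv : parent v <t v by apply: vlt_anc => //; exact: anc_parent.
rewrite dv -[k](_ : rk (parent v) = k); last by rewrite IH depth_parent dv //; lia.
rewrite rankE rankE (_ : [set x | x <t v] = parent v |: [set x | x <t parent v]).
  by rewrite cardsU1 in_set vltxx.
apply/setP => x; rewrite in_setU1 !in_set; apply/idP/orP => [xv|[/eqP -> //|h]]; last exact: vlt_trans pv.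
have xd : depth x < depth v.
  rewrite ltnNge; apply/negP => vx.
  have [e|nvx] := eqVneq v x; first by move: xv; rewrite e vltxx.
  by apply: (vlt_asym xv (vlt_anc _ nvx)); apply: anc_low => //; lia.
have [->|nx] := eqVneq x (parent v); first by left.
by right; apply: vlt_anc => //; apply: anc_low; rewrite ?depth_parent; lia.
Qed.

(** * Critical cells *)

Notation cell := (ncell V n).

Definition cell0 (v : 'I_n -> V) : cell := [ffun k => [set v k]].
(* The particle [e] occupies the edge below [v e], the particle [k] the vertex [v k]. *)
Definition cell1 (v : 'I_n -> V) (e : 'I_n) : cell :=
  [ffun k => if k == e then [set v k; parent (v k)] else [set v k]].

Lemma vtx1 x : vtx r [set x] = x.
Proof.
by rewrite /vtx; case: pickP => [y|/(_ x)]; rewrite in_set1 ?eqxx // => /eqP.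
Qed.

Lemma eupE v : eup adj r v = [set v; parent v].
Proof. by rewrite /eup step_root. Qed.

Lemma rkE v : rank adj r num v = rk v.
Proof. by rewrite /rk -lock. Qed.

Lemma card_edge w : w != r -> #|[set w; parent w]| = 2.
Proof. by move=> wr; rewrite cards2 eq_sym parent_neq. Qed.

Lemma inDP (a : cell) : reflect
  ((forall i, tcell adj (a i)) /\ (forall i j, i != j -> [disjoint a i & a j])) (inD adj a).
Proof.
apply: (iffP andP) => -[h1 h2]; split.
- exact/forallP.
- by move=> i j; move/forallP/(_ i)/forallP/(_ j)/implyP: h2.
- exact/forallP.
- by apply/forallP => i; apply/forallP => j; apply/implyP/h2.
Qed.

Lemma edge_in_tedges w : w != r -> [set w; parent w] \in tedges adj.
Proof. by move=> wr; rewrite tedgesE; apply/imsetP; exists w; rewrite ?in_setC1. Qed.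

Lemma inD_cell0 v : inD adj (cell0 v) <-> injective v.
Proof.
split => [/inDP [_ h] i j vij|inj].
  apply/eqP; apply: contraT => /h; rewrite !ffunE vij => /pred0P /(_ (v j)).
  by rewrite /= !in_set1 eqxx.
apply/inDP; split => [i|i j ij]; first by rewrite ffunE /tcell cards1.
by rewrite !ffunE disjoints1 in_set1; apply: contra ij => /eqP/inj ->.
Qed.

Lemma dim_cell0 v : dim (cell0 v) = 0.
Proof.
by apply/eqP; rewrite cards_eq0; apply/eqP/setP => k; rewrite !inE ffunE cards1.
Qed.

Lemma tcell_card2 c : tcell adj c -> #|c| = 2 -> exists2 w, w != r & c = [set w; parent w].
Proof.
rewrite /tcell => /orP [/eqP -> //|]; rewrite tedgesE => /imsetP [w].
by rewrite in_setC1 => wr ->; exists w.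
Qed.

Lemma tcell_card1 c : tcell adj c -> #|c| != 2 -> exists w, c = [set w].
Proof.
rewrite /tcell => /orP [/cards1P //|]; rewrite tedgesE => /imsetP [w].
by rewrite in_setC1 => wr ->; rewrite card_edge.
Qed.

Lemma card1_vtx (c : {set V}) : #|c| = 1 -> c = [set vtx r c].
Proof. by move=> /eqP/cards1P [w ->]; rewrite vtx1. Qed.

Lemma cell0_ex (a : cell) : (forall k, #|a k| = 1) -> a = cell0 (fun k => vtx r (a k)).
Proof. by move=> h; apply/ffunP => k; rewrite ffunE -card1_vtx. Qed.

Lemma cell0P (a : cell) : inD adj a -> dim a = 0 -> exists2 v, injective v & a = cell0 v.
Proof.
move=> aD /eqP; rewrite cards_eq0 => /eqP/setP h.
have aE : a = cell0 (fun k => vtx r (a k)).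
  apply: cell0_ex => k; have [/(_ k) tk _] := inDP _ aD.
  have [w ->] : exists w, a k = [set w]; last by rewrite cards1.
  by apply: tcell_card1 tk _; have := h k; rewrite !inE => ->.
by exists (fun k => vtx r (a k)) => //; apply/inD_cell0; rewrite -aE.
Qed.

Lemma cell1_e v e : cell1 v e e = [set v e; parent (v e)].
Proof. by rewrite ffunE eqxx. Qed.

Lemma cell1_neq v e k : k != e -> cell1 v e k = [set v k].
Proof. by rewrite ffunE => /negbTE ->. Qed.

Lemma inD_cell1 v e : v e != r ->
  inD adj (cell1 v e) <-> injective v /\ forall k, v k != parent (v e).
Proof.
move=> ve; split => [/inDP [_ h]|[inj h]].
  have h2 k : k != e -> (v k != v e) && (v k != parent (v e)).
    move=> ke; have := h _ _ ke; rewrite cell1_e cell1_neq // disjoints1 in_set2.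
    by rewrite negb_or.
  split=> [i j vij|k]; last first.
    have [->|/h2/andP []//] := eqVneq k e.
    by rewrite eq_sym parent_neq.
  apply/eqP; apply: contraT => ij.
  have [ie|ie] := eqVneq i e.
    by rewrite ie eq_sym in ij; have := h2 _ ij; rewrite -vij ie eqxx.
  have [je|je] := eqVneq j e; first by have := h2 _ ie; rewrite vij je eqxx.
  by have := h _ _ ij; rewrite !cell1_neq // disjoints1 in_set1 vij eqxx.
apply/inDP; split => [i|i j ij].
  rewrite ffunE /tcell; case: (i =P e) => [->|_]; last by rewrite cards1.
  by rewrite edge_in_tedges ?orbT.
have nvij : v i != v j by apply: contra ij => /eqP/inj ->.
have [ie|ie] := eqVneq i e.
  have je : j != e by rewrite -ie eq_sym.
  rewrite ie in nvij *; rewrite cell1_e cell1_neq // disjoint_sym disjoints1 in_set2.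
  by rewrite negb_or eq_sym nvij h.
have [je|je] := eqVneq j e.
  rewrite je in nvij *; rewrite cell1_e cell1_neq // disjoints1 in_set2.
  by rewrite negb_or nvij h.
by rewrite !cell1_neq // disjoints1 in_set1.
Qed.

Lemma edge_coord v e k : v e != r -> (#|cell1 v e k| == 2) = (k == e).
Proof. by move=> ve; rewrite ffunE; case: (k =P e) => [->|_]; rewrite ?card_edge ?cards1. Qed.

Lemma dim_cell1 v e : v e != r -> dim (cell1 v e) = 1.
Proof.
move=> ve; rewrite /dim (_ : [set _ | _] = [set e]) ?cards1 //.
by apply/setP => k; rewrite !inE edge_coord.
Qed.

Lemma cell1P (a : cell) : inD adj a -> dim a = 1 -> exists v e, v e != r /\ a = cell1 v e.
Proof.
move=> /inDP [tc _] /eqP/cards1P [e /setP h].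
have h2 k : (#|a k| == 2) = (k == e) by have := h k; rewrite !inE.
have [w wr we] : exists2 w, w != r & a e = [set w; parent w].
  by apply: tcell_card2 => //; apply/eqP; rewrite h2.
exists (fun k => if k == e then w else vtx r (a k)), e; rewrite eqxx; split=> //.
apply/ffunP => k; rewrite ffunE; case: (k =P e) => [->//|/eqP ke].
apply: card1_vtx; have [x ->] : exists x, a k = [set x]; last by rewrite cards1.
by apply: tcell_card1 (tc k) _; rewrite h2.
Qed.

(** For [cell1 v e] this is unblockedness in [cell0 v], which ignores the occupied lower end of the
    edge. That end enters as a separate condition in [unblocked_cell1]. *)
Definition free (v : 'I_n -> V) (k : 'I_n) : bool :=
  (v k != r) && [forall j, v j != parent (v k)].

Lemma unblocked_cell0 v k : injective v -> unblocked adj r (cell0 v) k = free v k.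
Proof.
move=> inj; rewrite /unblocked /blocked /free !ffunE cards1 /= vtx1 negb_or.
rewrite (inj_eq set1_inj); have [//|vr] /= := eqVneq (v k) r.
rewrite negb_exists; apply: eq_forallb => j; rewrite negb_and !negbK eupE ffunE.
rewrite disjoint_sym disjoints1 in_set2 negb_or (inj_eq inj).
by have [->|] //= := eqVneq j k; rewrite eq_sym parent_neq.
Qed.

Lemma unblocked_cell1 v e k : v e != r -> inD adj (cell1 v e) ->
  unblocked adj r (cell1 v e) k = [&& k != e, free v k & parent (v k) != parent (v e)].
Proof.
move=> ve /(inD_cell1 ve) [inj h]; have [->|ke] /= := eqVneq k e.
  by rewrite /unblocked cell1_e card_edge.
rewrite /unblocked /blocked /free cell1_neq // cards1 /= vtx1 negb_or.
rewrite (inj_eq set1_inj) -andbA; have [//|vr] /= := eqVneq (v k) r.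
rewrite negb_exists; apply/forallP/andP => [H|[/forallP H1 H2] j].
  have H2 j : j != k -> [disjoint [set v k; parent (v k)] & cell1 v e j].
    by move=> jk; have := H j; rewrite jk eupE /= negbK.
  split.
    apply/forallP => j; have [->|/H2] := eqVneq j k; first by rewrite eq_sym parent_neq.
    move=> /pred0P/(_ (v j)) /=; rewrite ffunE; case: ifP => _; rewrite !inE eqxx ?andbT.
      by move/negbT; rewrite negb_or => /andP [].
    by move/negbT; rewrite negb_or => /andP [].
  have := H2 e; rewrite eq_sym ke cell1_e => /(_ isT) /pred0P/(_ (parent (v e))) /=.
  by rewrite !inE eqxx orbT andbT => /negbT; rewrite negb_or => /andP [_]; rewrite eq_sym.
rewrite negb_and negbK; have [//|jk] /= := eqVneq j k; rewrite negbK eupE.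
have [->|je] := eqVneq j e.
  apply/pred0P => x /=; rewrite cell1_e !inE; apply/negbTE/negP.
  have nke : v k != v e by rewrite (inj_eq inj).
  move=> /andP [/orP [] /eqP -> /orP []].
  - by rewrite (negbTE nke).
  - by rewrite (negbTE (h k)).
  - by rewrite eq_sym (negbTE (H1 e)).
  - by rewrite (negbTE H2).
by rewrite cell1_neq // disjoint_sym disjoints1 in_set2 negb_or H1 (inj_eq inj) jk.
Qed.

Notation pr := (pr adj r num).

Lemma prN (a : cell) : pr a = None <-> forall i, ~~ unblocked adj r a i.
Proof.
rewrite /Defs.pr; case: pickP => [i /andP [ui _]|h]; split=> //.
  by move=> H; have := H i; rewrite ui.
move=> _ i; apply/negP => ui.
pose f j := rank adj r num (vtx r (a j)).
case: (arg_minnP f ui) => j uj jmin.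
have /negP [] := negbT (h j); rewrite uj /=.
by apply/forallP => l; apply/implyP/jmin.
Qed.

Lemma prS (a b : cell) : pr a = Some b -> exists i, [/\ unblocked adj r a i,
  forall j, unblocked adj r a j -> rk (vtx r (a i)) <= rk (vtx r (a j)) & b = er adj r a i].
Proof.
rewrite /Defs.pr; case: pickP => [i /andP [ui h]|//] [<-]; exists i; split=> // j uj.
by move/forallP/(_ j)/implyP/(_ uj): h; rewrite !rkE.
Qed.

Lemma prS_ex (a : cell) : pr a != None -> exists b, pr a = Some b.
Proof. by case: (pr a) => // b _; exists b. Qed.

Lemma er_cell0 v k : er adj r (cell0 v) k = cell1 v k.
Proof. by apply/ffunP => j; rewrite !ffunE vtx1 eupE; case: (j =P k) => [->|]. Qed.

Lemma pr_cell0N v : injective v -> pr (cell0 v) = None <-> forall k, ~~ free v k.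
Proof.
move=> inj; rewrite prN.
by split=> h k; have := h k; rewrite unblocked_cell0.
Qed.

Definition lowest_free (v : 'I_n -> V) (k : 'I_n) : Prop :=
  free v k /\ forall j, free v j -> rk (v k) <= rk (v j).

Lemma pr_cell0S v b : injective v ->
  pr (cell0 v) = Some b <-> exists2 k, lowest_free v k & b = cell1 v k.
Proof.
move=> inj; have S1 b' : pr (cell0 v) = Some b' -> exists2 k, lowest_free v k & b' = cell1 v k.
  move=> /prS [k [uk kmin ->]]; exists k; last exact: er_cell0.
  rewrite unblocked_cell0 // in uk; split=> // j.
  by rewrite -unblocked_cell0 // => /kmin; rewrite !ffunE !vtx1.
split; first exact: S1.
case=> k [fk kmin] ->.
have /prS_ex [b' bE] : pr (cell0 v) != None.
  by apply/eqP => /(pr_cell0N inj)/(_ k); rewrite fk.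
rewrite bE; have [k' [fk' k'min] ->] := S1 _ bE.
suff -> : k = k' by [].
by apply: inj; apply: rank_inj; apply/eqP; rewrite eqn_leq kmin // k'min.
Qed.

Lemma er_dim (a : cell) i : unblocked adj r a i -> dim (er adj r a i) = (dim a).+1.
Proof.
move=> /andP [/eqP ai]; rewrite negb_or => /andP [nair _].
have [w aw] : exists w, a i = [set w] by exists (vtx r (a i)); exact: card1_vtx.
have wr : w != r by apply: contra nair => /eqP <-; rewrite aw.
rewrite /dim (_ : [set k | _] = i |: [set k | #|a k| == 2]).
  by rewrite cardsU1 inE ai.
apply/setP => k; rewrite !inE ffunE; case: (k =P i) => [->|//].
by rewrite aw vtx1 eupE card_edge.
Qed.

Notation critical := (critical adj r num).

Lemma critical0 (a : cell) : dim a = 0 -> critical a <-> inD adj a /\ pr a = None.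
Proof.
move=> da; rewrite /Defs.critical /inW1 da.
have n2 : inW2 adj r num a = false.
  apply/existsP => -[b /andP [_ /eqP /prS [i [ui _ aE]]]].
  by move: da; rewrite aE er_dim.
rewrite n2 andbT /= da eqxx andbT /=.
case: (inD adj a) => /=; last by split=> // -[].
by case: (pr a) => [b|]; split=> // -[].
Qed.

Lemma crit0P (a : cell) : crit0 adj r num a <->
  exists v, [/\ injective v, a = cell0 v & forall k, ~~ free v k].
Proof.
split=> [/andP [ca /eqP da]|[v [inj -> h]]].
  have [aD pa] := (critical0 da).1 ca.
  have [v inj aE] := cell0P aD da; exists v; split=> //.
  by apply/(pr_cell0N inj); rewrite -aE.
rewrite /crit0 dim_cell0 andbT; apply/(critical0 (dim_cell0 v)).
by split; [exact/inD_cell0 | exact/pr_cell0N].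
Qed.

(** The first condition says that [pr] is undefined: any other free particle is blocked by the lower
    end of the edge. The second says that no 0-cell is paired with this cell: the only candidate is
    [cell0 v], and there [pr] would have to select [e] as the lowest free particle. *)
Lemma critical1 v e : v e != r -> inD adj (cell1 v e) -> critical (cell1 v e) <->
  (forall k, k != e -> free v k -> parent (v k) = parent (v e)) /\
  (exists2 k, free v k & rk (v k) < rk (v e)).
Proof.
move=> ve cD; have [inj h] := (inD_cell1 ve).1 cD.
have dc := dim_cell1 ve.
have W0 (b : cell) : dim b = 0 -> inW1 adj r num b = inD adj b && (pr b != None).
  by move=> db; rewrite /inW1 db /= db eqxx andbT.
have fe : free v e by rewrite /free ve; apply/forallP.
have W2 : inW2 adj r num (cell1 v e) <-> forall k, free v k -> rk (v e) <= rk (v k).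
  split=> [/existsP [b /andP [b1 /eqP prb]]|emin].
    have [i [ui _ bE]] := prS prb.
    have db : dim b = 0 by move: dc; rewrite bE er_dim // => -[].
    move: b1; rewrite W0 // => /andP [bD _]; have [w winj bw] := cell0P bD db.
    move: prb; rewrite bw => /(pr_cell0S _ winj) [k [fk kmin] /ffunP cE].
    have ek : e = k.
      have : #|cell1 w k e| == 2 by rewrite -cE edge_coord.
      by rewrite edge_coord; [move/eqP | case/andP: fk].
    have vw j : v j = w j.
      have [->|je] := eqVneq j e; last first.
        by have := cE j; rewrite !cell1_neq -?ek // => /set1_inj.
      have := cE e; rewrite -ek !cell1_e => eE.
      by apply: parent_edge_inj eE; rewrite in_setC1 // ek; case/andP: fk.
    move=> j fj; rewrite !vw ek; apply: kmin; move: fj; rewrite /free vw.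
    by move=> /andP [-> /forallP fj]; apply/forallP => l; rewrite -vw.
  apply/existsP; exists (cell0 v); rewrite W0 ?dim_cell0 //.
  have prE : pr (cell0 v) = Some (cell1 v e) by apply/pr_cell0S => //; exists e.
  by rewrite prE eqxx andbT andbT; apply/inD_cell0.
(* [pr] raises the dimension by one, so only 0-cells have to be searched and [inW2] agrees with the
   clause of [Wfirst] at level 1. *)
have W2' : inW2 adj r num (cell1 v e) = [exists b, Wfirst adj r num 0 b && (pr b == Some (cell1 v e))].
  apply: eq_existsb => b; apply: andb_id2r => /eqP prb.
  have [i [ui _ bE]] := prS prb.
  have db : dim b = 0 by move: dc; rewrite bE er_dim // => -[].
  by rewrite /inW1 db.
have W1 : inW1 adj r num (cell1 v e) = (pr (cell1 v e) != None) && ~~ inW2 adj r num (cell1 v e).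
  by rewrite W2' /inW1 dc [LHS]/= cD dc eqxx.
have PN : pr (cell1 v e) = None <->
    (forall k, k != e -> free v k -> parent (v k) = parent (v e)).
  rewrite prN; split=> H k; have := H k; rewrite unblocked_cell1 //.
    by move=> + ke fk; rewrite ke fk /= negbK => /eqP.
  by move=> H'; apply/and3P => -[ke fk /eqP]; apply; apply: H'.
have -> : critical (cell1 v e) = (pr (cell1 v e) == None) && ~~ inW2 adj r num (cell1 v e).
  by rewrite /Defs.critical cD W1 /=; case: (inW2 _ _ _ _); rewrite ?andbF ?andbT ?negbK.
split=> [/andP [/eqP pN n2]|[/PN -> [k fk ke]]].
  split; first exact/PN.
  have [k /andP [fk ke]|nk] := pickP (fun k => free v k && (rk (v k) < rk (v e))); first by exists k.
  case/negP: n2; apply/W2 => k fk.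
  by have := nk k; rewrite fk /= ltnNge => /negbFE.
by rewrite eqxx /=; apply/negP => /W2/(_ k fk); rewrite leqNgt ke.
Qed.

(** * The gradient flow on 0-cells *)

Definition upd (v : 'I_n -> V) (k j : 'I_n) : V := if j == k then parent (v k) else v j.
Definition pos (v : 'I_n -> V) (k : 'I_n) : nat := #|[set j | rk (v j) < rk (v k)]|.

Lemma eq_pos v w : v =1 w -> pos v =1 pos w.
Proof. by move=> vw k; apply: eq_card => j; rewrite !in_set !vw. Qed.

Lemma eq_cell0 v w : v =1 w -> cell0 v = cell0 w.
Proof. by move=> vw; apply/ffunP => k; rewrite !ffunE vw. Qed.

(** Going from [u] towards [z] through occupied vertices must stop before the empty vertex [z], and
    it stops at a free particle. *)
Lemma free_below v z u : (forall j, v j != z) -> anc z u -> (exists j, v j = u) ->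
  exists l, free v l /\ anc (v l) u.
Proof.
move=> zv; move: {2}(depth u) (erefl (depth u)) => m.
elim: m u => [|m IH] u du zu [j ju].
  have := anc_depth_eq zu; rewrite du => /(_ isT) e.
  by have := zv j; rewrite ju e eqxx.
have ur : u != r by rewrite -depth_eq0 du.
have nzu : z != u by apply: contraNneq (zv j) => zE; rewrite ju zE.
have [l /eqP lu|nl] := pickP (fun l => v l == parent u).
  have [|||l' [fl al]] := IH (parent u); first by rewrite depth_parent du.
  - exact: anc_parentr.
  - by exists l.
  - by exists l'; split=> //; apply: anc_trans al (anc_parent u).
exists j; rewrite ju ancxx; split=> //; rewrite /free ju ur.
by apply/forallP => l; rewrite nl.
Qed.

(* An occupied vertex in between would lie above [parent (v k)], and the lowest occupied
   vertex on the way to it would be a free particle below [v k]. *)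
Lemma no_between v k j : lowest_free v k -> parent (v k) <t v j -> v j <t v k -> False.
Proof.
case=> /andP [vr /forallP vp] kmin h1 h2.
have a := anc_convex (anc_parent _) h1 h2.
have [|l [fl al]] := free_below vp a; first by exists j.
have := kmin _ fl; rewrite leqNgt rank_ltn => /negP; apply.
have [<- //|nl] := eqVneq (v j) (v l).
by apply: vlt_trans h2; apply: vlt_anc; rewrite // eq_sym.
Qed.

Lemma upd_inj v k : injective v -> (forall j, v j != parent (v k)) -> injective (upd v k).
Proof.
move=> inj vp i j; rewrite /upd; case: eqP => [->|_]; case: eqP => [->|_] //.
- by move=> e; move: (vp j); rewrite e eqxx.
- by move=> e; move: (vp i); rewrite e eqxx.
- exact: inj.
Qed.

(** By [no_between], another particle precedes [parent (v k)] iff it precedes [v k]. *)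
Lemma upd_order v k i j : injective v -> lowest_free v k ->
  (rk (upd v k i) < rk (upd v k j)) = (rk (v i) < rk (v j)).
Proof.
move=> inj lf; have [/andP [vr /forallP vp] _] := lf.
have pv : parent (v k) <t v k by apply: vlt_anc; [exact: anc_parent | exact: parent_neq].
rewrite /upd !rank_ltn; have [->|ik] := eqVneq i k; have [->|jk] := eqVneq j k.
- by rewrite !tltE !lex_irr.
- have njk : v j != v k by rewrite (inj_eq inj).
  apply/idP/idP => [h|]; last exact: vlt_trans pv.
  by have /orP [h2|//] := vlt_total njk; case: (no_between lf h h2).
- apply/idP/idP => [h|h]; first exact: vlt_trans h pv.
  by have /orP [//|h2] := vlt_total (vp i); case: (no_between lf h2 h).
- by [].
Qed.

Notation flowstep := (@flowstep V adj r num n).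
Notation phi := (@phi V adj r num n).
Notation tau_of := (@tau_of V adj r num n).

Lemma flowstep_free v k : injective v -> lowest_free v k ->
  flowstep (cell0 v) = cell0 (upd v k).
Proof.
move=> inj lf; have prE : pr (cell0 v) = Some (cell1 v k) by apply/pr_cell0S => //; exists k.
rewrite /Defs.flowstep prE ifN; last first.
  by apply/negP => /(critical0 (dim_cell0 v)) [_]; rewrite prE.
have [/andP [vr _] _] := lf.
apply/ffunP => j; rewrite ffunE /upd [cell0 (upd v k) j]ffunE /upd.
have [->|jk] := eqVneq j k; last by rewrite cell1_neq // ffunE eqxx.
rewrite cell1_e ffunE; case: eqP => [/setP/(_ (parent (v k)))|_].
  by rewrite in_set1 in_set2 eqxx orbT (negbTE (parent_neq vr)).
apply/setP => x; rewrite !inE; have [->|] //= := eqVneq x (v k).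
by rewrite eq_sym (negbTE (parent_neq vr)).
Qed.

Lemma flowstep_settled v : injective v -> (forall k, ~~ free v k) -> flowstep (cell0 v) = cell0 v.
Proof.
move=> inj h; rewrite /Defs.flowstep ifT //; apply/(critical0 (dim_cell0 v)).
by split; [exact/inD_cell0 | exact/pr_cell0N].
Qed.

Lemma lowest_free_ex v : (forall k, ~~ free v k) \/ exists k, lowest_free v k.
Proof.
have [k fk|nf] := pickP (free v); last by left=> k; rewrite nf.
by right; case: (arg_minnP (fun j => rk (v j)) fk) => j fj jmin; exists j.
Qed.

(** The sum of the depths is the termination measure: each step lowers it by one, and it is positive
    while some particle is free. *)
Lemma flow_iter m v : injective v -> \sum_k depth (v k) <= m -> exists w,
  [/\ injective w, forall k, ~~ free w k, pos w =1 pos v & iter m flowstep (cell0 v) = cell0 w].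
Proof.
elim: m v => [|m IH] v inj; rewrite ?iterSr => sm; have [nf|[k lf]] := lowest_free_ex v.
- by exists v.
- have [/andP [+ _] _] := lf.
  by move: sm; rewrite (bigD1 k) //= leqn0 addn_eq0 depth_eq0 => /andP [-> _].
- by exists v; split=> //; rewrite -iterSr; elim: m.+1 => //= m' ->; rewrite flowstep_settled.
have [/andP [vr /forallP vp] _] := lf.
have [|w [winj nf wp e]] := IH _ (upd_inj inj vp).
  have -> : \sum_j depth (upd v k j) = (depth (v k)).-1 + \sum_(j | j != k) depth (v j).
    rewrite (bigD1 k) //= {1}/upd eqxx depth_parent; congr (_ + _).
    by apply: eq_bigr => j jk; rewrite /upd (negbTE jk).
  by move: sm vr; rewrite (bigD1 k) //= -depth_eq0; lia.
exists w; split=> //; last by rewrite (flowstep_free inj lf).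
by move=> l; rewrite wp; apply: eq_card => j; rewrite !in_set (upd_order _ _ inj lf).
Qed.

Lemma depth_ltn_card v : depth v < #|V|.
Proof.
have u := @uniq_traject v (depth v) (leqnn _).
by rewrite -(size_traject parent v (depth v).+1) -(card_uniqP u) max_card.
Qed.

(** [phi] iterates [#|{: cell}|] times, that is 2 ^ (#|V| * n), which exceeds the bound n * #|V| on
    the sum of the depths. So [phi] reaches the end of the flow. *)
Lemma sum_depth_cell (v : 'I_n -> V) : \sum_k depth (v k) <= #|{: cell}|.
Proof.
rewrite card_ffun card_ord -cardsT -powersetT card_powerset cardsT -expnM.
apply: leq_trans (ltnW (ltn_expl _ _)) => //.
apply: leq_trans (_ : \sum_(k < n) #|V| <= _).
  by apply: leq_sum => k _; exact/ltnW/depth_ltn_card.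
by rewrite sum_nat_const card_ord mulnC.
Qed.

(** Closure under parents puts all ancestors of [v k], which are [(depth (v k)).+1] distinct
    vertices, among the places of the particles in [L]. *)
Lemma settled_depth (v : 'I_n -> V) (L : {set 'I_n}) k :
  (forall k, k \in L -> v k != r -> exists2 j, j \in L & v j = parent (v k)) ->
  k \in L -> depth (v k) < #|L|.
Proof.
move=> cl kL; have H m : iter m parent (v k) \in v @: L.
  elim: m => [|m /imsetP [j jL e]]; first exact: imset_f.
  rewrite iterS e; have [jr|vr] := eqVneq (v j) r.
    by rewrite jr parent_root -jr imset_f.
  by have [l lL <-] := cl _ jL vr; exact: imset_f.
have u := @uniq_traject (v k) (depth (v k)) (leqnn _).
apply: leq_trans (leq_imset_card v _).
rewrite -(size_traject parent (v k) (depth (v k)).+1) -(card_uniqP u).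
by apply/subset_leq_card/subsetP => x /trajectP [m _ ->].
Qed.

Lemma notfreeP v k : ~~ free v k -> v k != r -> exists j, v j = parent (v k).
Proof.
move=> + vr; rewrite /free vr /= negb_forall => /existsP [j].
by rewrite negbK => /eqP; exists j.
Qed.

Lemma settled_rank v k : (forall k, ~~ free v k) -> rk (v k) < n.
Proof.
move=> nf; have h : depth (v k) < #|[set: 'I_n]|.
  apply: settled_depth => [l _ vr|]; last by rewrite in_setT.
  by have [j] := notfreeP (nf l) vr; exists j; rewrite ?in_setT.
by rewrite cardsT card_ord in h; rewrite rank_low.
Qed.

Lemma card_ord_ltn c : c <= n -> #|[set m : 'I_n | m < c]| = c.
Proof.
move=> cn; have winj : injective (widen_ord cn) by move=> i j /(congr1 val) e; apply: val_inj.
rewrite -[RHS]card_ord -(card_imset _ winj).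
apply: eq_card => m; rewrite in_set; apply/idP/imsetP => [mc|[l _ ->]]; last exact: (ltn_ord l).
by exists (Ordinal mc) => //; apply: val_inj.
Qed.

Lemma pos_low v k : injective v -> (forall k, rk (v k) < n) -> pos v k = rk (v k).
Proof.
move=> inj vn; pose f j := Ordinal (vn j).
have finj : injective f by move=> i j /(congr1 val) /rank_inj/inj.
rewrite -[RHS](card_ord_ltn (ltnW (vn k))) -[LHS](card_imset _ finj).
apply: eq_card => m; rewrite in_set; apply/imsetP/idP => [[j jk ->]|mk].
  by move: jk; rewrite in_set.
have /codomP [j mj] := injF_onto finj m.
by exists j => //; rewrite in_set; move: mk; rewrite mj.
Qed.

Lemma tau_of_cell0 v k : tau_of (cell0 v) k = rk (v k).
Proof. by rewrite /Defs.tau_of ffunE vtx1 rkE. Qed.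

(** At the end of the flow the ranks are below [n], so rank and position coincide there by
    [pos_low], and positions are unchanged by the flow. *)
Lemma tau_of_phi v k : injective v -> tau_of (phi (cell0 v)) k = pos v k.
Proof.
move=> inj; have [w [winj nf wp e]] := flow_iter inj (sum_depth_cell v).
rewrite /Defs.phi e tau_of_cell0 -wp pos_low // => l; exact: settled_rank.
Qed.

(** * Critical 0-cells as permutations *)

Definition trunk (m : nat) : V := odflt r [pick v | depth v == m].

Lemma depth_trunk m : m < n -> depth (trunk m) = m.
Proof.
move=> mn; rewrite /trunk; case: pickP => [v /eqP //|h].
by have [v /eqP] := depth_ex mn; rewrite h.
Qed.

Lemma rank_trunk m : m < n -> rk (trunk m) = m.
Proof. by move=> mn; rewrite rank_low depth_trunk. Qed.

Lemma trunk_rank v : rk v < n -> trunk (rk v) = v.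
Proof. by move=> vn; apply: rank_inj; rewrite rank_trunk. Qed.

Lemma trunk_inj m m' : m < n -> m' < n -> trunk m = trunk m' -> m = m'.
Proof. by move=> mn mn' /(congr1 depth); rewrite !depth_trunk. Qed.

Definition perm_cell (tau : 'S_n) : cell := cell0 (fun k => trunk (tau k)).

Lemma tau_of_perm_cell tau k : tau_of (perm_cell tau) k = tau k.
Proof. by rewrite tau_of_cell0 rank_trunk. Qed.

Lemma perm_cell_crit0 tau : crit0 adj r num (perm_cell tau).
Proof.
apply/crit0P; exists (fun k => trunk (tau k)); split=> // [i j e|k].
  by apply/(@perm_inj _ tau)/val_inj; apply: trunk_inj e.
rewrite /free negb_and negbK; apply/orP.
have [kr|kr] := eqVneq (trunk (tau k)) r; [by left | right].
rewrite negb_forall; apply/existsP.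
have lt : depth (parent (trunk (tau k))) < n.
  by rewrite depth_parent depth_trunk //; have := ltn_ord (tau k); lia.
exists (tau^-1%g (Ordinal lt)); rewrite permKV negbK /=; apply/eqP.
by rewrite -[X in trunk X]rank_low // trunk_rank // rank_low.
Qed.

Lemma crit0_perm a : crit0 adj r num a -> exists tau, a = perm_cell tau.
Proof.
move=> /crit0P [v [inj -> nf]]; pose f k := Ordinal (settled_rank k nf).
have finj : injective f by move=> i j /(congr1 val) /rank_inj/inj.
exists (perm finj); apply: eq_cell0 => k; rewrite permE /= trunk_rank //.
exact: settled_rank.
Qed.

Lemma perm_cell_eq (a : cell) (f : 'I_n -> 'I_n) : inD adj a -> (forall k, #|a k| = 1) ->
  (forall k, tau_of a k = f k) -> a = cell0 (fun k => trunk (f k)).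
Proof.
move=> aD a1 h; rewrite {1}(cell0_ex a1); apply: eq_cell0 => k.
by rewrite -h /Defs.tau_of rkE trunk_rank // -rkE -/(tau_of a k) h.
Qed.

Lemma crit0_surj a : crit0 adj r num a <->
  inD adj a /\ (forall k, #|a k| = 1) /\ (forall m : 'I_n, exists k, tau_of a k = m).
Proof.
split=> [ca|[aD [a1 sur]]].
  have [tau aE] := crit0_perm ca; rewrite aE in ca *; split; first by case/andP: ca => /andP [].
  split=> [k|m]; first by rewrite ffunE cards1.
  by exists (tau^-1%g m); rewrite tau_of_perm_cell permKV.
have /fin_all_exists [g gE] := sur.
have ginj : injective g by move=> i j e; apply: val_inj; rewrite /= -!gE e.
suff -> : a = perm_cell (perm ginj)^-1%g by exact: perm_cell_crit0.
by apply: perm_cell_eq => // k; rewrite -gE -(permE ginj) permKV.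
Qed.

Lemma perm_cell_inj : injective perm_cell.
Proof.
move=> s t e; apply/permP => k; apply: val_inj.
by rewrite /= -!tau_of_perm_cell e.
Qed.

Lemma card_crit0 : #|[set a : cell | crit0 adj r num a]| = n`!.
Proof.
rewrite -card_Sn -(card_imset _ perm_cell_inj); apply: eq_card => a.
rewrite in_set; apply/idP/imsetP => [/crit0_perm [tau ->]|[tau _ ->]]; first by exists tau.
exact: perm_cell_crit0.
Qed.

Lemma crit0_perm_uniq (tau : 'S_n) : exists! a : cell,
  crit0 adj r num a /\ forall k, tau_of a k = tau k.
Proof.
exists (perm_cell tau); split; first by split; [exact: perm_cell_crit0 | exact: tau_of_perm_cell].
move=> a [/crit0_perm [s ->] h]; congr perm_cell; apply/permP => k; apply: val_inj.
by rewrite /= -h tau_of_perm_cell.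
Qed.

(** * Critical 1-cells *)

Definition crit_edge (v : 'I_n -> V) (e : 'I_n) : Prop :=
  [/\ v e != r, injective v, forall k, v k != parent (v e),
      forall k, k != e -> free v k -> parent (v k) = parent (v e) &
      exists2 k, free v k & rk (v k) < rk (v e)].

Lemma crit1P (c : cell) : crit1 adj r num c <-> exists v e, c = cell1 v e /\ crit_edge v e.
Proof.
split=> [/andP [cc /eqP dc]|[v [e [-> [ve inj vp h1 h2]]]]].
  have cD : inD adj c by case/and3P: cc.
  have [v [e [ve cE]]] := cell1P cD dc; exists v, e; split=> //.
  rewrite cE in cc cD; have [inj h] := (inD_cell1 ve).1 cD.
  by have [] := (critical1 ve cD).1 cc.
have cD : inD adj (cell1 v e) by apply/inD_cell1.
by rewrite /crit1 dim_cell1 // andbT; apply/critical1.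
Qed.

Lemma lo_end_edge w : w != r -> lo_end adj r num [set w; parent w] = parent w.
Proof.
move=> wr; have pw : parent w <t w by apply: vlt_anc; [exact: anc_parent | exact: parent_neq].
have vt x y : vlt adj r num x y = (x <t y) by rewrite /tlt -lock.
rewrite /lo_end; case: pickP => [x|/(_ (parent w))] /=.
  rewrite in_set2 => /andP [/orP [/eqP ->|/eqP ->//] /forallP/(_ (parent w))].
  by rewrite in_set2 eqxx orbT parent_neq //= vt => /(vlt_asym pw).
rewrite in_set2 eqxx orbT /= => /negbT/negP; case; apply/forallP => y.
by rewrite in_set2; apply/implyP => /orP [] /eqP ->; rewrite ?eqxx // vt pw implybT.
Qed.

Lemma hi_end_edge w : w != r -> hi_end adj r num [set w; parent w] = w.
Proof.
move=> wr; have pw : parent w <t w by apply: vlt_anc; [exact: anc_parent | exact: parent_neq].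
have vt x y : vlt adj r num x y = (x <t y) by rewrite /tlt -lock.
rewrite /hi_end; case: pickP => [x|/(_ w)] /=.
  rewrite in_set2 => /andP [/orP [/eqP ->//|/eqP ->] /forallP/(_ w)].
  by rewrite in_set2 eqxx eq_sym parent_neq //= vt => /(vlt_asym pw).
rewrite in_set2 eqxx /= => /negbT/negP; case; apply/forallP => y.
by rewrite in_set2; apply/implyP => /orP [] /eqP ->; rewrite ?eqxx // vt pw implybT.
Qed.

Lemma replace_cell1 v e f : v e != r -> replace_by (cell1 v e) f =
  cell0 (fun k => if k == e then f [set v e; parent (v e)] else v k).
Proof.
move=> ve; rewrite /replace_by /ecoord; case: pickP => [i|/(_ e)]; rewrite edge_coord ?eqxx //.
move=> /eqP ->; apply/ffunP => k; rewrite !ffunE eqxx.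
by case: (k == e).
Qed.

Definition src : cell -> 'I_n -> nat := locked (fun c => tau_of (gsrc adj r num c)).
Definition tgt : cell -> 'I_n -> nat := locked (fun c => tau_of (gtgt adj r num c)).

Lemma srcE c k : tau_of (gsrc adj r num c) k = src c k.
Proof. by rewrite /src -lock. Qed.

Lemma tgtE c k : tau_of (gtgt adj r num c) k = tgt c k.
Proof. by rewrite /tgt -lock. Qed.

Lemma src_cell1 v e k : v e != r -> injective v -> (forall k, v k != parent (v e)) ->
  src (cell1 v e) k = pos (upd v e) k.
Proof.
move=> ve inj vp; rewrite -srcE /gsrc replace_cell1 // lo_end_edge // -/(upd v e).
by rewrite tau_of_phi //; exact: upd_inj.
Qed.

Lemma tgt_cell1 v e k : v e != r -> injective v -> tgt (cell1 v e) k = pos v k.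
Proof.
move=> ve inj; rewrite -tgtE /gtgt replace_cell1 // hi_end_edge //.
rewrite (@eq_cell0 _ v) => [|j]; first exact: tau_of_phi.
by case: eqP => [->|].
Qed.

(** The two ends of a 1-cell differ only in the particle [e], so its contribution to a position is
    split off. *)
Lemma pos_split v e k : pos v k = #|[set j | (j != e) && (rk (v j) < rk (v k))]| + (rk (v e) < rk (v k)).
Proof.
rewrite /pos (cardsD1 e) in_set addnC; congr (_ + _).
by apply: eq_card => j; rewrite !inE.
Qed.

Lemma pos_upd_split v e k : k != e ->
  pos (upd v e) k = #|[set j | (j != e) && (rk (v j) < rk (v k))]| + (rk (parent (v e)) < rk (v k)).
Proof.
move=> ke; rewrite (pos_split _ e) /upd eqxx (negbTE ke); congr (_ + _).
by apply: eq_card => j; rewrite !in_set; case: eqP.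
Qed.

Lemma pos_upd_self v e : v e != r ->
  pos (upd v e) e = #|[set j | (j != e) && (rk (v j) < rk (parent (v e)))]|.
Proof.
move=> ve; rewrite (pos_split _ e) /upd eqxx ltnn addn0.
by apply: eq_card => j; rewrite !in_set; case: eqP.
Qed.

Lemma pos_ltn v k l : rk (v k) < rk (v l) -> pos v k < pos v l.
Proof.
move=> kl; apply/proper_card/properP; split.
  by apply/subsetP => j; rewrite !in_set => /ltn_trans; apply.
by exists k; rewrite in_set ?ltnn.
Qed.

(** The particles outside the subtree at the lower end of the edge. Their number is the n - i of the
    edge class. *)
Definition stem (v : 'I_n -> V) (e : 'I_n) : {set 'I_n} :=
  [set k | ~~ anc (parent (v e)) (v k)].

(** * The two endpoints of a critical edge *)

Section CriticalEdge.
Variables (v : 'I_n -> V) (e : 'I_n).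
Hypothesis ce : crit_edge v e.
Notation x := (parent (v e)).
Notation L := (stem v e).

Let ve : v e != r. Proof. by case: ce. Qed.
Let inj : injective v. Proof. by case: ce. Qed.
Let vx k : v k != x. Proof. by case: ce => _ _ h _ _; exact: h. Qed.
Let xe : child x (v e). Proof. by apply/childP. Qed.

(** The smaller free particle hangs at the lower end of the edge as well; with [v e] it makes that
    vertex essential. *)
Lemma crit_edge_sibling : exists2 k, child x (v k) & rk (v k) < rk (v e).
Proof.
have [_ _ _ h [k fk ke]] := ce; exists k => //; apply/childP; split; first by case/andP: fk.
by apply: h => //; apply: contraTneq ke => ->; rewrite ltnn.
Qed.

Lemma crit_edge_deg : x != r /\ 2 < deg adj x.
Proof.
have [k xk ke] := crit_edge_sibling; apply: deg_two_children xk xe _.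
by apply: contraTneq ke => ->; rewrite ltnn.
Qed.

Let e_notin_L : e \notin L.
Proof. by rewrite in_set negbK child_anc. Qed.

Lemma below_gtn k : k \notin L -> rk x < rk (v k).
Proof.
by rewrite in_set negbK => a; rewrite rank_ltn vlt_anc // eq_sym.
Qed.

(** A free particle other than [e] has parent [x], hence is not in the stem. So a stem particle is
    not free, and the particle on its parent is again in the stem. *)
Lemma stem_parent k : k \in L -> v k != r -> exists2 j, j \in L & v j = parent (v k).
Proof.
rewrite in_set => kL kr.
have nke : k != e by apply: contraNneq kL => ->; exact: child_anc.
have nf : ~~ free v k.
  by case: ce => _ _ _ h _; apply: contra kL => /(h k nke) hk; rewrite -hk; exact: anc_parent.
have [j jk] := notfreeP nf kr; exists j => //; rewrite in_set jk.
by apply: contra kL => /anc_trans; apply; exact: anc_parent.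
Qed.

Lemma trunk_depth k : k \in L -> depth (v k) < #|L|.
Proof. by apply: settled_depth => {}k; exact: stem_parent. Qed.

Lemma card_trunk : #|L|.+2 <= n.
Proof.
have [k xk ke] := crit_edge_sibling.
have h : k != e by apply: contraTneq ke => ->; rewrite ltnn.
have : #|[set k; e]| <= #|~: L|.
  apply/subset_leq_card/subsetP => j; rewrite in_set2 in_setC in_set negbK.
  by move=> /orP [] /eqP ->; exact: child_anc.
by rewrite cards2 h; have := cardsC L; rewrite card_ord; lia.
Qed.

(** The stem is closed under parents and has at most n - 2 particles, so its particles have depth
    less than n - 2, where each level is a single vertex. *)
Lemma trunk_anc k u : k \in L -> n.-1 <= depth u -> anc (v k) u.
Proof.
move=> /trunk_depth kd du; have := card_trunk => cL.
by apply: anc_low; lia.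
Qed.

Lemma trunk_ltn k u : k \in L -> v k != u -> n.-1 <= depth u -> rk (v k) < rk u.
Proof. by move=> kL nu du; rewrite rank_ltn vlt_anc //; exact: trunk_anc. Qed.

Let x_depth : n.-1 <= depth x.
Proof. by apply: essential_depth; case: crit_edge_deg. Qed.

Lemma trunk_ltn_edge k : k \in L -> rk (v k) < rk x.
Proof. by move=> kL; apply: trunk_ltn => //; exact: vx. Qed.

Lemma mem_trunk k : (k \in L) = (rk (v k) < rk x).
Proof.
apply/idP/idP; first exact: trunk_ltn_edge.
by apply: contraTT => /below_gtn h; rewrite -leqNgt ltnW.
Qed.

Lemma pos_upd_edge : pos (upd v e) e = #|L|.
Proof.
rewrite pos_upd_self //; apply: eq_card => j; rewrite mem_trunk in_set.
by rewrite andb_idl // => jx; apply: contraTneq jx => ->; rewrite -leqNgt ltnW ?below_gtn.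
Qed.

Lemma pos_upd_trunk k : k \in L -> pos (upd v e) k = pos v k.
Proof.
move=> kL; have nke : k != e by apply: contraTneq kL => ->.
rewrite pos_upd_split // (pos_split v e k); congr (_ + nat_of_bool _).
have h1 := trunk_ltn_edge kL; have h2 := below_gtn e_notin_L.
by apply/idP/idP => h; [have := ltn_trans h h1 | have := ltn_trans h (ltn_trans h1 h2)]; rewrite ltnn.
Qed.

Lemma pos_trunk k : k \in L -> pos v k < #|L|.
Proof.
move=> kL; apply/proper_card/properP; split; last by exists k; rewrite // in_set ltnn.
apply/subsetP => j; rewrite mem_trunk in_set => jk.
by apply: ltn_trans jk _; rewrite -mem_trunk.
Qed.

Lemma pos_below k : k \notin L -> #|L| <= pos v k.
Proof.
move=> kL; apply/subset_leq_card/subsetP => j; rewrite mem_trunk in_set => jx.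
exact: ltn_trans jx (below_gtn kL).
Qed.

(** When [e] drops from [v e] to [x], it passes exactly the particles of the subtree that precede
    [v e], and each of them gains one position. *)
Lemma pos_upd_below k : k \notin L -> k != e ->
  pos (upd v e) k = (if rk (v k) < rk (v e) then (pos v k).+1 else pos v k).
Proof.
move=> kL ke; rewrite pos_upd_split // (pos_split v e k) below_gtn //.
have : rk (v k) != rk (v e) by rewrite (inj_eq rank_inj) (inj_eq inj).
by case: ltngtP => // _ _; rewrite addn0 addn1.
Qed.

Lemma pos_edge_gtn : #|L| < pos v e.
Proof.
have [k xk ke] := crit_edge_sibling.
apply: leq_trans (pos_ltn ke); apply: pos_below.
by rewrite in_set negbK child_anc.
Qed.

Lemma pos_ltn_n w k : pos w k < n.
Proof.
rewrite -[X in _ < X]card_ord -cardsT; apply/proper_card/properP; split.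
  exact: subsetT.
by exists k; rewrite in_set ?ltnn.
Qed.

Lemma crit_edge_cycle i j : 2 <= j -> j <= i -> i <= n -> n - i = #|L| -> n - i + j - 1 = pos v e ->
  forall k, cycnat n i j (pos v k) = pos (upd v e) k.
Proof.
move=> j2 ji iN iL jp k; rewrite /cycnat jp iL.
have [kL|kL] := boolP (k \in L).
  rewrite pos_upd_trunk // leqNgt pos_trunk //= ifN //.
  by have := pos_trunk kL; have := pos_edge_gtn; lia.
have [->|ke] := eqVneq k e; first by rewrite ltnn andbF eqxx pos_upd_edge.
rewrite pos_below // pos_upd_below //=.
have : rk (v k) != rk (v e) by rewrite (inj_eq rank_inj) (inj_eq inj).
case: (ltngtP (rk (v k))) => // h _; first by rewrite pos_ltn.
by have := pos_ltn h; case: (ltngtP (pos v k)).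
Qed.

Lemma crit_edge_bounds : exists i j, [/\ 2 <= j, j <= i, i <= n,
  n - i = #|L| & n - i + j - 1 = pos v e].
Proof.
(* [i] counts the particles above [x], including [e] at [v e], and [j] is the place of [e] among
   them, counted from one. *)
exists (n - #|L|), (pos v e - #|L|).+1.
have h1 := card_trunk; have h2 := pos_edge_gtn; have h3 := pos_ltn_n v e.
by split; lia.
Qed.

End CriticalEdge.

(** * Filling the branches of an essential vertex *)

Definition nth_child (x : V) (b : nat) : V := odflt r [pick c | child x c && (num x c == b)].
Definition first_child (v : V) : V := odflt r [pick c | child v c].

(* Position of the [s]-th particle above [x], when the particles have branch numbers [b 0],
   [b 1], and so on: it sits on top of its predecessor if both lie in the same branch. *)
Fixpoint walk (x : V) (b : nat -> nat) (s : nat) : V :=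
  if s is s'.+1 then
    if b s == b s' then first_child (walk x b s') else nth_child x (b s)
  else nth_child x (b 0).

Lemma nth_childP x b : x != r -> 0 < b < deg adj x ->
  child x (nth_child x b) /\ num x (nth_child x b) = b.
Proof.
move=> xr /(num_surj xr) [c xc cb]; rewrite /nth_child.
by case: pickP => [c' /andP [xc' /eqP cb']|/(_ c)] //=; rewrite xc cb eqxx.
Qed.

Lemma nth_child_num x c : child x c -> nth_child x (num x c) = c.
Proof.
move=> xc; rewrite /nth_child; case: pickP => [d /andP [xd /eqP e]|/(_ c)] /=.
  exact: num_inj e.
by rewrite xc eqxx.
Qed.

Lemma first_childP v : (exists c, child v c) -> child v (first_child v).
Proof. by move=> [c vc]; rewrite /first_child; case: pickP => [//|/(_ c)]; rewrite vc. Qed.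

Lemma gnum_child x c v : child x c -> anc c v -> gnum adj num x v = num x c.
Proof. by move=> /childP [cr cx] cv; rewrite /gnum (step_down cr cx cv). Qed.

Lemma eq_walk x b b' i s : (forall s, s < i -> b s = b' s) -> s < i -> walk x b s = walk x b' s.
Proof.
move=> bb; elim: s => [|s IH] si /=; first by rewrite bb.
by rewrite !bb ?IH //; exact: ltnW.
Qed.

Section Walk.
Variables (x : V) (b : nat -> nat) (i j : nat).
Hypothesis x_ess : 2 < deg adj x.
Hypotheses (j_gt1 : 1 < j) (j_le_i : j <= i) (i_le_n : i <= n).
Hypothesis b_bounds : forall s, s < i -> 0 < b s < deg adj x.
Hypothesis b_leq : forall s, s.+1 < i -> b s <= b s.+1.
Hypothesis b_jump : b j.-2 < b j.-1.

Let x_neq_r : x != r.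
Proof. by apply: contraTneq x_ess => ->; rewrite degr. Qed.

(** Consecutive particles climb by at most one level, and the strict jump at particle [j.-1] starts
    a new branch, which saves one level from there on. A particle whose successor stays in its
    branch is therefore fewer than [n.-1] levels above [x], where subdivision still provides a next
    vertex. *)
Lemma walk_inv s : s < i -> exists c, [/\ child x c, num x c = b s, anc c (walk x b s) &
  depth (walk x b s) <= depth x + s + (s < j.-1)].
Proof.
elim: s => [|s IH] si.
  have [c1 c2] := nth_childP x_neq_r (b_bounds si).
  by exists (nth_child x (b 0)); rewrite /= ancxx (child_depth c1); split=> //; lia.
rewrite [walk _ _ _]/=; case: eqP => [e|ne]; last first.
  have [c1 c2] := nth_childP x_neq_r (b_bounds si).
  by exists (nth_child x (b s.+1)); rewrite ancxx (child_depth c1); split=> //; lia.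
have [c [xc cb ca cd]] := IH (ltnW si); exists c.
have sj : s.+1 != j.-1.
  by apply/eqP => sj; move: b_jump; rewrite (_ : j.-2 = s) -?sj ?e ?ltnn //; lia.
have xw : anc x (walk x b s) by apply: anc_trans (child_anc xc) ca.
have nxw : x != walk x b s.
  by apply: contraTneq (anc_depth ca) => <-; rewrite (child_depth xc); lia.
have d : depth (walk x b s) - depth x < n.-1 by lia.
have /first_childP wc := child_ex_above x_ess xw nxw d.
split=> //; first by rewrite e.
  by apply: anc_trans ca (child_anc wc).
by rewrite (child_depth wc); lia.
Qed.

Lemma walk_depth_gtn s : s < i -> depth x < depth (walk x b s).
Proof.
by move=> si; have [c [xc _ /anc_depth + _]] := walk_inv si; rewrite (child_depth xc).
Qed.

Lemma walk_anc s : s < i -> anc x (walk x b s).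
Proof.
by move=> si; have [c [xc _ ca _]] := walk_inv si; apply: anc_trans (child_anc xc) ca.
Qed.

Lemma gnum_walk s : s < i -> gnum adj num x (walk x b s) = b s.
Proof. by move=> si; have [c [xc <- ca _]] := walk_inv si; apply: gnum_child. Qed.

Lemma walk_same s : s.+1 < i -> b s.+1 = b s -> child (walk x b s) (walk x b s.+1).
Proof.
move=> si e; rewrite [walk x b s.+1]/= e eqxx; apply: first_childP.
have [c [xc cb ca cd]] := walk_inv (ltnW si).
apply: (child_ex_above x_ess (walk_anc (ltnW si))).
  by apply: contraTneq (walk_depth_gtn (ltnW si)) => <-; rewrite ltnn.
have sj : s.+1 != j.-1.
  by apply/eqP => sj; move: b_jump; rewrite (_ : j.-2 = s) -?sj ?e ?ltnn //; lia.
by lia.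
Qed.

Lemma walk_diff s : s.+1 < i -> b s.+1 != b s -> child x (walk x b s.+1).
Proof.
move=> si ne; rewrite [walk x b s.+1]/= (negbTE ne).
by case: (nth_childP x_neq_r (b_bounds si)).
Qed.

Lemma walk_0 : child x (walk x b 0).
Proof. by case: (nth_childP x_neq_r (@b_bounds 0 _)) => //; lia. Qed.

Lemma walk_edge : child x (walk x b j.-1).
Proof.
have jE : j.-1 = j.-2.+1 by lia.
by rewrite jE; apply: walk_diff; rewrite -jE; [lia | rewrite gtn_eqF].
Qed.

Lemma walk_ltnS s : s.+1 < i -> rk (walk x b s) < rk (walk x b s.+1).
Proof.
move=> si; rewrite rank_ltn; have [e|ne] := eqVneq (b s.+1) (b s).
  have w := walk_same si e; apply: vlt_anc; first exact: child_anc.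
  by apply/eqP => we; have := child_depth w; rewrite -we; lia.
have [c [xc cb ca _]] := walk_inv (ltnW si).
have [d [xd db da _]] := walk_inv si.
apply: vlt_branch xc xd _ ca da; rewrite cb db ltn_neqAle eq_sym ne.
exact: b_leq.
Qed.

Lemma walk_ltn s t : s < t -> t < i -> rk (walk x b s) < rk (walk x b t).
Proof.
elim: t => [//|t IH]; rewrite ltnS leq_eqVlt => /orP [/eqP ->|st] ti; first exact: walk_ltnS.
by apply: ltn_trans (IH st (ltnW ti)) _; exact: walk_ltnS.
Qed.

Definition placement (k : 'I_n) : V := if k < n - i then trunk k else walk x b (k - (n - i)).

Let placement_walk (k : 'I_n) : ~~ (k < n - i) -> k - (n - i) < i.
Proof. by have := ltn_ord k; lia. Qed.

Let x_depth : n.-1 <= depth x.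
Proof. exact: essential_depth. Qed.

Lemma placement_ltn (k l : 'I_n) : k < l -> rk (placement k) < rk (placement l).
Proof.
move=> kl; rewrite /placement; case: ifPn => kn; case: ifPn => ln.
- by rewrite !rank_trunk.
- have li := placement_walk ln.
  rewrite rank_ltn vlt_anc //; first by apply: anc_low; rewrite depth_trunk //; have := walk_depth_gtn li; lia.
  by apply/eqP => /(congr1 depth); rewrite depth_trunk //; have := walk_depth_gtn li; lia.
- by lia.
- by apply: walk_ltn; rewrite ?placement_walk //; lia.
Qed.

Lemma placement_anc (k : 'I_n) : anc x (placement k) = ~~ (k < n - i).
Proof.
rewrite /placement; case: ifPn => [kn|/placement_walk/walk_anc //].
by apply/negbTE/negP => /anc_depth; rewrite depth_trunk //; lia.
Qed.

Lemma placement_neq (k : 'I_n) : placement k != x.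
Proof.
rewrite /placement; case: ifPn => [kn|/placement_walk/walk_depth_gtn h].
  by apply/eqP => /(congr1 depth); rewrite depth_trunk //; lia.
by apply: contraTneq h => ->; rewrite ltnn.
Qed.

Lemma pos_increasing (v : 'I_n -> V) k :
  (forall k l : 'I_n, k < l -> rk (v k) < rk (v l)) -> pos v k = k.
Proof.
move=> vinc; rewrite -[RHS](card_ord_ltn (ltnW (ltn_ord k))).
apply: eq_card => l; rewrite !in_set; apply/idP/idP; last exact: vinc.
apply: contraTT; rewrite -!leqNgt leq_eqVlt => /orP [/eqP/val_inj -> //|/vinc]; exact: ltnW.
Qed.

Variable e : 'I_n.
Hypothesis eE : e = n - i + j.-1 :> nat.

Lemma placement_e : child x (placement e).
Proof.
rewrite /placement eE ifN; last by lia.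
by rewrite addKn; exact: walk_edge.
Qed.

(** A particle other than [e] sits at the root, on top of its predecessor, or at the start of a
    branch of [x]; only the last kind is free, and its parent is [x]. The first local particle is
    the required smaller free one, since 1 < j. *)
Lemma placement_crit_edge : crit_edge placement e.
Proof.
have [er ep] := childP _ _ placement_e.
have inj : injective placement.
  move=> k l kl; apply: val_inj; case: (ltngtP k l) => // /placement_ltn.
    by rewrite kl ltnn.
  by rewrite kl ltnn.
split=> //; rewrite ?ep; first exact: placement_neq.
  move=> k ke /andP [kr /forallP kf]; have [kn|kn] := boolP (k < n - i).
    have pk : placement k = trunk k by rewrite /placement kn.
    rewrite pk in kr kf *; have d := depth_parent (trunk k); rewrite depth_trunk // in d.
    have k0 : 0 < k by move: kr; rewrite -depth_eq0 depth_trunk //; lia.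
    have k1 : k.-1 < n by lia.
    have := kf (Ordinal k1); rewrite /placement ifT /=; last by lia.
    rewrite (_ : parent _ = trunk k.-1) ?eqxx //.
    by apply: depth_inj_low; rewrite ?depth_parent !depth_trunk //; lia.
  have pk : placement k = walk x b (k - (n - i)) by rewrite /placement (negbTE kn).
  move: kr kf; rewrite pk; have := placement_walk kn; case E: (k - (n - i)) => [|s] si.
    by case/childP: walk_0.
  have [es|ne] := eqVneq (b s.+1) (b s); last by case/childP: (walk_diff si ne).
  have /childP [_ wp] := walk_same si es.
  have k1 : k.-1 < n by have := ltn_ord k; lia.
  move=> _ /(_ (Ordinal k1)); rewrite wp /placement ifN /=; last by lia.
  by rewrite (_ : _ - _ = s) ?eqxx //; lia.
have k0 : n - i < n by lia.
have pE : placement (Ordinal k0) = walk x b 0 by rewrite /placement ltnn subnn.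
exists (Ordinal k0).
  have /childP [wr wp] := walk_0.
  by rewrite /free pE wr /=; apply/forallP => l; rewrite wp placement_neq.
by apply: placement_ltn => /=; lia.
Qed.

End Walk.

(** * The edge classes and their sizes *)

(** Along a critical edge only the edge coordinate has a larger target than source. As 2 <= j, the
    coordinate [k] must be this one, and the pair of its values determines [i] and [j]. *)
Definition edge_class (i j : nat) : {set cell} :=
  [set c | crit1 adj r num c &&
    [exists k, (src c k == n - i) && (tgt c k == n - i + j - 1)]].

Lemma src_crit_edge v e k : crit_edge v e -> src (cell1 v e) k = pos (upd v e) k.
Proof. by case=> ve inj vp _ _; exact: src_cell1. Qed.

Lemma tgt_crit_edge v e k : crit_edge v e -> tgt (cell1 v e) k = pos v k.
Proof. by case=> ve inj _ _ _; exact: tgt_cell1. Qed.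

Lemma cell1_edge_class v e i j : crit_edge v e ->
  n - i = #|stem v e| -> n - i + j - 1 = pos v e -> cell1 v e \in edge_class i j.
Proof.
move=> ce iL jp; rewrite in_set; apply/andP; split; first by apply/crit1P; exists v, e.
apply/existsP; exists e.
rewrite src_crit_edge //.
rewrite tgt_crit_edge //.
rewrite (pos_upd_edge ce).
by rewrite -iL -jp !eqxx.
Qed.

Lemma edge_classP c i j : 2 <= j -> j <= i -> i <= n -> c \in edge_class i j ->
  exists v e, [/\ c = cell1 v e, crit_edge v e, n - i = #|stem v e| & n - i + j - 1 = pos v e].
Proof.
move=> j2 ji iN; rewrite in_set => /andP [/crit1P [v [e [-> ce]]] /existsP [k]].
rewrite src_crit_edge // tgt_crit_edge // => /andP [/eqP sk /eqP tk].
exists v, e; have [i' [j' [j2' ji' iN' iL jp]]] := crit_edge_bounds ce.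
have := crit_edge_cycle ce j2' ji' iN' iL jp k; rewrite sk tk /cycnat => cyc.
suff [-> ->] : i = i' /\ j = j' by [].
by move: cyc; case: ifP => h1; [|case: eqP => h2]; lia.
Qed.

Lemma crit1_edge_class c : crit1 adj r num c <->
  exists i j, [/\ 2 <= j, j <= i, i <= n & c \in edge_class i j].
Proof.
split=> [/crit1P [v [e [-> ce]]]|[i [j [_ _ _]]]]; last by rewrite in_set => /andP [].
have [i [j [j2 ji iN iL jp]]] := crit_edge_bounds ce.
by exists i, j; split=> //; exact: cell1_edge_class.
Qed.

Lemma edge_class_disjoint i j i' j' c : 2 <= j -> j <= i -> i <= n ->
  2 <= j' -> j' <= i' -> i' <= n ->
  c \in edge_class i j -> c \in edge_class i' j' -> i = i' /\ j = j'.
Proof.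
move=> j2 ji iN j2' ji' iN' cE; have [v [e [cv ce iL jp]]] := edge_classP j2 ji iN cE.
move=> /(edge_classP j2' ji' iN') [w [f [cw cf iL' jp']]].
have [[ve _ _ _ _] [wf _ _ _ _]] := (ce, cf).
have ef : e = f by apply/eqP; rewrite -(edge_coord e wf) -cw cv edge_coord.
have h1 : n - i = n - i'.
  by rewrite iL iL' -(pos_upd_edge ce) -(pos_upd_edge cf) -src_crit_edge // -cv cw src_crit_edge // ef.
have h2 : n - i + j - 1 = n - i' + j' - 1.
  by rewrite jp jp' -(tgt_crit_edge e ce) -cv cw tgt_crit_edge // ef.
lia.
Qed.

Lemma edge_class_cycle i j c k : 2 <= j -> j <= i -> i <= n -> c \in edge_class i j ->
  cycnat n i j (tgt c k) = src c k.
Proof.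
move=> j2 ji iN /(edge_classP j2 ji iN) [v [e [-> ce iL jp]]].
by rewrite tgt_crit_edge // src_crit_edge // (crit_edge_cycle ce).
Qed.

(** * The action of the symmetric group *)

Lemma cact_cell1 v e (mu : 'S_n) : cact (cell1 v e) mu = cell1 (v \o mu) (mu^-1%g e).
Proof.
apply/ffunP => k; rewrite !ffunE /= -(inj_eq (@perm_inj _ mu) k) permKV.
by [].
Qed.

Lemma free_perm v (mu : 'S_n) k : free (v \o mu) k = free v (mu k).
Proof.
rewrite /free /=; congr (_ && _); apply/forallP/forallP => h j; last exact: (h (mu j)).
by have := h (mu^-1%g j); rewrite permKV.
Qed.

Lemma crit_edge_perm v e (mu : 'S_n) : crit_edge v e -> crit_edge (v \o mu) (mu^-1%g e).
Proof.
case=> ve inj vp h [k fk ke]; split; rewrite /= ?permKV //.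
- by move=> a b /= /inj/perm_inj.
- by move=> k' k'e; rewrite free_perm; apply: h; apply: contra k'e => /eqP <-; rewrite permK.
- by exists (mu^-1%g k); rewrite ?free_perm permKV.
Qed.

Lemma pos_perm v (mu : 'S_n) k : pos (v \o mu) k = pos v (mu k).
Proof.
rewrite -[RHS](card_preimset _ (@perm_inj _ mu)).
by apply: eq_card => j; rewrite !inE.
Qed.

Lemma upd_perm v e (mu : 'S_n) : upd (v \o mu) (mu^-1%g e) =1 upd v e \o mu.
Proof. by move=> k; rewrite /upd /= permKV -(inj_eq (@perm_inj _ mu) k) permKV. Qed.

Lemma edge_class_cact i j c (mu : 'S_n) : 2 <= j -> j <= i -> i <= n -> c \in edge_class i j ->
  [/\ cact c mu \in edge_class i j, forall k, src (cact c mu) k = src c (mu k) &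
      forall k, tgt (cact c mu) k = tgt c (mu k)].
Proof.
move=> j2 ji iN /(edge_classP j2 ji iN) [v [e [-> ce iL jp]]].
have ce' := crit_edge_perm mu ce; rewrite cact_cell1; split=> [|k|k].
- apply: cell1_edge_class => //; last by rewrite pos_perm permKV.
  rewrite iL -(pos_upd_edge ce) -(pos_upd_edge ce') (eq_pos (upd_perm v e mu)) pos_perm permKV //.
- by rewrite !src_crit_edge // (eq_pos (upd_perm v e mu)) pos_perm.
- by rewrite !tgt_crit_edge // pos_perm.
Qed.

(** * The number of edges with a given source *)

Section Count.
Variables (i j : nat).
Hypotheses (j_gt1 : 1 < j) (j_le_i : j <= i) (i_le_n : i <= n).

Lemma cycnat_ltn (m : 'I_n) : cycnat n i j m < n.
Proof. by have := ltn_ord m; rewrite /cycnat; case: ifP => h; [|case: eqP => h2]; lia. Qed.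

Lemma cycnat_inj a b : cycnat n i j a = cycnat n i j b -> a = b.
Proof.
by rewrite /cycnat; (case: ifP => h1; [|case: eqP => h2]); (case: ifP => h3; [|case: eqP => h4]); lia.
Qed.

Definition tgt_id : {set cell} := [set c in edge_class i j | [forall k, tgt c k == k]].

Lemma mem_tgt_id c : (c \in tgt_id) = (c \in edge_class i j) && [forall k, tgt c k == k].
Proof. exact: in_set. Qed.

(* The action moves the cells with source [tau] to those whose target is the identity. *)
Lemma card_src_tau (tau : 'S_n) :
  #|[set c in edge_class i j | [forall k, src c k == tau k]]| = #|tgt_id|.
Proof.
(* [p] solves tau o p = sigma_(i,j). Since sigma_(i,j) applied to the target gives the source tau,
   precomposing with [p] turns the target into the identity. *)
pose f (m : 'I_n) : 'I_n := (tau^-1)%g (Ordinal (cycnat_ltn m)).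
have finj : injective f by move=> a b /perm_inj/(congr1 val) /cycnat_inj/val_inj.
pose p := perm finj.
have tp m : tau (p m) = cycnat n i j m :> nat by rewrite permE /f permKV.
pose g (c : cell) := cact c p.
have ginj : injective g.
  move=> c d /ffunP e; apply/ffunP => k; have := e (p^-1%g k).
  by rewrite !ffunE permKV.
rewrite -(card_imset _ ginj); apply: eq_card => c.
apply/imsetP/idP => [[d]|].
  rewrite in_set => /andP [dE /forallP dt ->]; rewrite mem_tgt_id.
  have [gE _ gt] := edge_class_cact p j_gt1 j_le_i i_le_n dE.
  rewrite [g d \in _]gE /=; apply/forallP => k; rewrite gt.
  apply/eqP/cycnat_inj; rewrite (edge_class_cycle _ j_gt1 j_le_i i_le_n dE) -tp.
  exact/eqP.
rewrite mem_tgt_id => /andP [cE /forallP ct]; exists (cact c p^-1%g); last first.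
  by apply/ffunP => k; rewrite !ffunE permK.
have [gE gs _] := edge_class_cact p^-1%g j_gt1 j_le_i i_le_n cE.
rewrite in_set gE /=; apply/forallP => k; rewrite gs.
by rewrite -(edge_class_cycle _ j_gt1 j_le_i i_le_n cE) (eqP (ct _)) -tp permKV.
Qed.

Lemma edge_index_subproof : n - i + j.-1 < n. Proof. by lia. Qed.
(** When the target is the identity, the index of the edge particle is its position n - i + j - 1,
    so the edge coordinate is known in advance. *)
Definition edge_index : 'I_n := Ordinal edge_index_subproof.
Definition low_end (c : cell) : V := lo_end adj r num (c edge_index).

Lemma tgt_idP c : c \in tgt_id -> exists v,
  [/\ c = cell1 v edge_index, crit_edge v edge_index, n - i = #|stem v edge_index|,
      low_end c = parent (v edge_index) & forall k, pos v k = k].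
Proof.
rewrite mem_tgt_id => /andP [/(edge_classP j_gt1 j_le_i i_le_n) [v [e [-> ce iL jp]]] /forallP h].
have vid k : pos v k = k by have := h k; rewrite tgt_crit_edge // => /eqP.
have <- : e = edge_index by apply: val_inj; rewrite /= -(vid e) -jp; lia.
exists v; split=> //; rewrite /low_end.
have -> : edge_index = e by apply: val_inj; rewrite /= -(vid e) -jp; lia.
by rewrite cell1_e lo_end_edge //; case: ce.
Qed.

Lemma pos_leq_rank v k : injective v -> pos v k <= rk (v k).
Proof.
move=> inj; rewrite /pos -(card_imset _ inj) [X in _ <= X]rankE.
apply/subset_leq_card/subsetP => u /imsetP [l + ->].
by rewrite !in_set rank_ltn.
Qed.

(** The particles up to [k] in the vertex order belong to the stem and are closed under parents, so
    [settled_depth] applies to them; there are [(pos v k).+1] of them. *)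
Lemma depth_leq_pos v e k : crit_edge v e -> k \in stem v e -> depth (v k) <= pos v k.
Proof.
move=> ce kL; have inj : injective v by case: ce.
pose L := [set l | rk (v l) <= rk (v k)].
have kL' : k \in L by rewrite in_set.
have h : depth (v k) < #|L|.
  apply: settled_depth kL' => l; rewrite in_set => lk lr.
  have lL : l \in stem v e.
    rewrite (mem_trunk ce); apply: leq_ltn_trans lk _; by rewrite -(mem_trunk ce).
  have [m _ mE] := stem_parent ce lL lr; exists m => //; rewrite in_set mE.
  apply: leq_trans lk; rewrite ltnW // rank_ltn; apply: vlt_anc; first exact: anc_parent.
  exact: parent_neq.
rewrite -ltnS; apply: leq_trans h _; rewrite /pos -addn1 addnC.
apply: leq_trans (_ : #|k |: [set j | rk (v j) < rk (v k)]| <= _); last first.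
  by rewrite cardsU1 in_set ltnn.
apply/subset_leq_card/subsetP => l; rewrite !inE leq_eqVlt.
by move=> /orP [/eqP/rank_inj/inj ->|->]; rewrite ?eqxx ?orbT.
Qed.

(** * Recovering a critical edge from its branch numbers *)

Section Decode.
Variable v : 'I_n -> V.
Hypothesis ce : crit_edge v edge_index.
Hypothesis card_stem : n - i = #|stem v edge_index|.
Hypothesis pos_id : forall k, pos v k = k.
Notation x := (parent (v edge_index)).

Let inj : injective v. Proof. by case: ce. Qed.

Lemma mem_stem k : (k \in stem v edge_index) = (k < n - i).
Proof.
apply/idP/idP => [/(pos_trunk ce)|]; first by rewrite pos_id card_stem.
by apply: contraTT => /(pos_below ce); rewrite pos_id card_stem -leqNgt.
Qed.

(** A squeeze: depth is at most position, position at most rank, and rank equals depth on the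
    trunk. *)
Lemma decode_stem (k : 'I_n) : k < n - i -> v k = trunk k.
Proof.
rewrite -mem_stem => kL; have := depth_leq_pos ce kL; have := pos_leq_rank k inj.
rewrite pos_id => h1 h2; have dn : depth (v k) < n by apply: leq_ltn_trans h2 _.
rewrite (rank_low dn) in h1.
by rewrite -[LHS]trunk_rank rank_low //; congr trunk; apply/eqP; rewrite eqn_leq h1 h2.
Qed.

Lemma decode_ltn (k l : 'I_n) : k < l -> rk (v k) < rk (v l).
Proof.
move=> kl; rewrite ltnNge leq_eqVlt; apply/negP => /orP [/eqP/rank_inj/inj lk|/pos_ltn].
  by rewrite lk ltnn in kl.
by rewrite !pos_id ltnNge ltnW.
Qed.

Definition local_index (s : nat) : 'I_n := insubd edge_index (n - i + s).
Notation z s := (v (local_index s)).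
Notation beta := (fun s => gnum adj num x (z s)).

Lemma local_indexE s : s < i -> local_index s = n - i + s :> nat.
Proof. by move=> si; rewrite val_insubd ifT //; lia. Qed.

Lemma local_edge : local_index j.-1 = edge_index.
Proof. by apply: val_inj; rewrite /= local_indexE //; lia. Qed.

Lemma local_ltn s t : s < t -> t < i -> rk (z s) < rk (z t).
Proof. by move=> st ti; apply: decode_ltn; rewrite !local_indexE //; lia. Qed.

Lemma local_anc s : s < i -> anc x (z s).
Proof.
move=> si; have : local_index s \notin stem v edge_index.
  by rewrite mem_stem local_indexE //; lia.
by rewrite in_set negbK.
Qed.

Lemma local_neq s : x != z s.
Proof. by rewrite eq_sym; case: ce. Qed.

Lemma edge_child : child x (v edge_index).
Proof. by apply/childP; case: ce. Qed.

Lemma local_parent s : s < i ->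
  child x (z s) \/ [/\ s != j.-1 & exists2 t, t < s & child (z t) (z s)].
Proof.
move=> si; have [->|sj] := eqVneq s j.-1; first by left; rewrite local_edge; exact: edge_child.
have sr : z s != r.
  by have := anc_ltn (local_anc si) (local_neq s); rewrite -depth_eq0; lia.
have se : local_index s != edge_index.
  by apply/eqP => /(congr1 val) /=; rewrite local_indexE //; lia.
have [fs|nfs] := boolP (free v (local_index s)).
  by left; apply/childP; split=> //; case: ce => _ _ _ h _; exact: h.
right; split=> //; have [l lp] := notfreeP nfs sr.
have cl : child (v l) (z s) by apply/childP; rewrite lp.
have ls : l < local_index s.
  have := vlt_anc (child_anc cl); rewrite lp parent_neq // -lp => /(_ isT).
  rewrite -rank_ltn => lt; rewrite ltnNge leq_eqVlt; apply/negP => /orP [/eqP/val_inj e|/decode_ltn].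
    by rewrite e ltnn in lt.
  by rewrite ltnNge ltnW.
have ln : n - i <= l.
  rewrite leqNgt -mem_stem in_set negbK lp.
  by apply: anc_parentr; [exact: local_anc | exact: local_neq].
rewrite local_indexE // in ls.
exists (l - (n - i)); first by lia.
suff -> : local_index (l - (n - i)) = l by [].
by apply: val_inj; rewrite /= local_indexE; lia.
Qed.

(** If [z s] sat on an earlier [z t] other than [z s.-1], then [z s.-1] would lie between them in
    the order, hence above [z t]. The depth bound makes [z s] the only child of [z t], so [z s.-1]
    would lie above [z s] and could not precede it. *)
Lemma local_step s : s < i -> depth (z s) <= depth x + s + (s < j.-1) /\
  (child x (z s) \/ [/\ 0 < s, s != j.-1 & child (z s.-1) (z s)]).
Proof.
elim/ltn_ind: s => s IH si.
have xe := (crit_edge_deg ce).2.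
have [xs|[sj [t ts ct]]] := local_parent si.
  by split; [rewrite (child_depth xs); lia | left].
have [td _] := IH t ts (ltn_trans ts si).
have [tE|tN] := eqVneq t s.-1.
  by split; [rewrite (child_depth ct); lia | right; split=> //; [lia | rewrite -tE]].
have l1 : rk (z t) < rk (z s.-1) by apply: local_ltn; lia.
have l2 : rk (z s.-1) < rk (z s) by apply: local_ltn; lia.
have a : anc (z t) (z s.-1).
  by apply: (anc_convex (child_anc ct)); rewrite -rank_ltn.
have ne : z t != z s.-1 by apply: contraTneq l1 => ->; rewrite ltnn.
have [c tc ca] := child_ex a ne.
have d : depth (z t) - depth x < n.-1 by lia.
have cs : c = z s := child_uniq_above xe (local_anc (ltn_trans ts si)) (local_neq t) d tc ct.
rewrite cs in ca; have nse : z s != z s.-1 by apply: contraTneq l2 => ->; rewrite ltnn.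
by have := vlt_anc ca nse; rewrite -rank_ltn ltnNge ltnW.
Qed.

Lemma local_beta s : s.+1 < i ->
  [/\ child (z s) (z s.+1), beta s.+1 = beta s & s.+1 != j.-1] \/
  (child x (z s.+1) /\ beta s < beta s.+1).
Proof.
move=> si; have as' := local_anc (ltnW si).
have [c xc ca] := child_ex as' (local_neq s).
have [_ [xs|[_ sj cs]]] := local_step si; last first.
  left; split=> //; rewrite (gnum_child xc ca); apply: gnum_child => //.
  exact: anc_trans ca (child_anc cs).
right; split=> //; rewrite (gnum_child xc ca) (gnum_child xs (ancxx _)).
have lt := local_ltn (ltnSn s) si; rewrite rank_ltn in lt.
case: (ltngtP (num x c)) => // [h|/(num_inj xc xs) h].
  by case: (vlt_asym lt); apply: vlt_branch xs xc h (ancxx _) ca.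
rewrite h in ca; case: (vlt_asym lt); apply: vlt_anc => //.
by apply/eqP => e; rewrite e vltxx in lt.
Qed.

(** The edge particle hangs at [x], so it cannot continue the branch of its predecessor. *)
Lemma beta_edge : beta j.-2 < beta j.-1.
Proof.
have jE : j.-1 = j.-2.+1 by lia.
have [|[_ _ /eqP]|[]] := @local_beta j.-2; rewrite -?jE //.
by lia.
Qed.

Lemma beta_leq s : s.+1 < i -> beta s <= beta s.+1.
Proof. by move=> si; have [[_ -> _]|[_ /ltnW]] := local_beta si. Qed.

Lemma beta_bounds s : s < i -> 0 < beta s < deg adj x.
Proof.
move=> si; have [c xc ca] := child_ex (local_anc si) (local_neq s).
by rewrite (gnum_child xc ca) num_bounds //; case: (crit_edge_deg ce).
Qed.

Lemma local_walk s : s < i -> walk x beta s = z s.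
Proof.
have nthE t : child x (z t) -> nth_child x (beta t) = z t.
  by move=> xt; rewrite (gnum_child xt (ancxx _)) nth_child_num.
elim: s => [|s IH] si.
  by have [_ [/nthE|[]]] := local_step si.
rewrite [LHS]/= IH; last exact: ltnW.
have [[cs -> sj]|[xs lt]] := local_beta si; last by rewrite gtn_eqF // nthE.
rewrite eqxx; have [sd _] := local_step (ltnW si).
have d : depth (z s) - depth x < n.-1 by lia.
apply: (child_uniq_above (crit_edge_deg ce).2 (local_anc (ltnW si)) (local_neq s) d) => //.
by apply: first_childP; exists (z s.+1).
Qed.

Lemma decode_placement k : v k = placement x beta i k.
Proof.
rewrite /placement; case: ifPn => kn; first exact: decode_stem.
have ki : k - (n - i) < i by have := ltn_ord k; lia.
rewrite local_walk //; congr v; apply: val_inj; rewrite /= local_indexE //; lia.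
Qed.

End Decode.

(** * Critical edges at a fixed essential vertex *)

Section FixedVertex.
Variables (x : V) (d : nat).
Hypothesis deg_x : deg adj x = d.+3.

Let x_ess : 2 < deg adj x. Proof. by rewrite deg_x. Qed.

(* In a critical edge at [x], the branches of the [i] local particles weakly increase,
   with a strict increase just before the particle [j.-1] that sits on the edge; the
   shift by [j.-1 <= s] turns this into an arbitrary weakly increasing sequence. *)
Definition branch_seq (t : i.-tuple 'I_d.+1) (s : nat) : nat :=
  nth 0 (map val t) s + 1 + (j.-1 <= s).

Definition tuple_cell (t : i.-tuple 'I_d.+1) : cell :=
  cell1 (placement x (branch_seq t) i) edge_index.

Lemma branch_seq_admissible (t : i.-tuple 'I_d.+1) : sorted leq (map val t) ->
  [/\ forall s, s < i -> 0 < branch_seq t s < deg adj x,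
      forall s, s.+1 < i -> branch_seq t s <= branch_seq t s.+1 &
      branch_seq t j.-2 < branch_seq t j.-1].
Proof.
move=> /(sortedP 0) ts; rewrite size_map size_tuple in ts.
have ji : j.-2.+1 < i by lia.
have jE : j.-2.+1 = j.-1 by lia.
split=> [s si|s si|]; rewrite /branch_seq.
- rewrite (nth_map ord0) ?size_tuple // deg_x.
  by have := ltn_ord (nth ord0 t s); rewrite /=; case: (_ <= s) => /=; lia.
- by have := ts s si; lia.
- by have := ts _ ji; rewrite jE; lia.
Qed.

Lemma tuple_cell_tgt_id (t : i.-tuple 'I_d.+1) : sorted leq (map val t) ->
  tuple_cell t \in tgt_id /\ low_end (tuple_cell t) = x.
Proof.
move=> /branch_seq_admissible [b1 b2 b3]; have eE : edge_index = n - i + j.-1 :> nat by [].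
have ce := placement_crit_edge x_ess j_gt1 j_le_i i_le_n b1 b2 b3 eE.
have /childP [er ep] := placement_e x_ess j_gt1 j_le_i i_le_n b1 b3 eE.
have pid k := pos_increasing k (placement_ltn x_ess j_gt1 j_le_i i_le_n b1 b2 b3).
split; last by rewrite /low_end cell1_e lo_end_edge.
rewrite mem_tgt_id; apply/andP; split.
  apply: cell1_edge_class => //; last by rewrite pid /=; lia.
  rewrite -[LHS](@card_ord_ltn (n - i)) ?leq_subr //; apply: eq_card => k.
  by rewrite !in_set ep (placement_anc x_ess j_gt1 j_le_i i_le_n b1 b3) negbK.
by apply/forallP => k; rewrite tgt_crit_edge // pid.
Qed.

Lemma tuple_cell_inj : {in [set t : i.-tuple 'I_d.+1 | sorted leq (map val t)] &, injective tuple_cell}.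
Proof.
move=> t t'; rewrite !in_set => ts ts' /ffunP e.
have [b1 b2 b3] := branch_seq_admissible ts.
have [b1' b2' b3'] := branch_seq_admissible ts'.
have eE : edge_index = n - i + j.-1 :> nat by [].
have /childP [er _] := placement_e x_ess j_gt1 j_le_i i_le_n b1 b3 eE.
have /childP [er' _] := placement_e x_ess j_gt1 j_le_i i_le_n b1' b3' eE.
have pE k : placement x (branch_seq t) i k = placement x (branch_seq t') i k.
  have := e k; have [->|ke] := eqVneq k edge_index; last by rewrite !cell1_neq // => /set1_inj.
  by rewrite !cell1_e => /parent_edge_inj; apply; rewrite in_setC1.
have bE s : s < i -> branch_seq t s = branch_seq t' s.
  move=> si; have sn : n - i + s < n by lia.
  have ns : (n - i + s < n - i) = false by lia.
  have := pE (Ordinal sn); rewrite /placement /= ns addKn => w.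
  rewrite -(gnum_walk x_ess j_gt1 j_le_i i_le_n b1 b3 si) w.
  exact: (gnum_walk x_ess j_gt1 j_le_i i_le_n b1' b3' si).
apply: eq_from_tnth => s; apply: val_inj; have := bE s (ltn_ord s).
rewrite /branch_seq !(nth_map ord0) ?size_tuple // !(tnth_nth ord0) /=; lia.
Qed.

Lemma tgt_id_tuple_cell c : c \in tgt_id -> low_end c = x ->
  exists2 t : i.-tuple 'I_d.+1, sorted leq (map val t) & c = tuple_cell t.
Proof.
move=> /tgt_idP [v [-> ce vL -> vid]] xE.
have [b [b1 b2 b3 dec]] : exists b : nat -> nat,
  [/\ forall s, s < i -> 0 < b s < deg adj x, forall s, s.+1 < i -> b s <= b s.+1,
      b j.-2 < b j.-1 & forall k, v k = placement x b i k].
  have b1 := beta_bounds ce vL vid; have b2 := beta_leq ce vL vid.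
  have b3 := beta_edge ce vL vid; have dec := decode_placement ce vL vid.
  by rewrite xE in b1 b2 b3 dec; eexists; split; [exact: b1 | exact: b2 | exact: b3 | exact: dec].
have bmono s s' : s <= s' -> s' < i -> b s <= b s'.
  elim: s' => [|s' IH]; first by rewrite leqn0 => /eqP ->.
  rewrite leq_eqVlt => /orP [/eqP -> //|ss'] si.
  by apply: leq_trans (IH ss' (ltnW si)) (b2 _ si).
(* The inverse of the shift in [branch_seq]. From [j.-1] on, b s is at least 2, so both subtractions
   are exact; before that, b s is at most b j.-2 < b j.-1, which leaves room below d + 1. *)
pose f (s : nat) := b s - 1 - (j.-1 <= s).
have fd s : s < i -> f s + 1 + (j.-1 <= s) = b s /\ f s < d.+1.
  move=> si; have /andP [s1 s2] := b1 s si; rewrite deg_x in s2.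
  have [js|sj] := leqP j.-1 s; rewrite /f.
    have h := bmono _ _ js si; have j2 : j.-2 < i by lia.
    by have := b1 _ j2; rewrite ?js /=; lia.
  have j1 : j.-1 < i by lia.
  have := b1 _ j1; rewrite deg_x => /andP [_ j2].
  have h : b s <= b j.-2 by apply: bmono; lia.
  by rewrite (leqNgt j.-1) sj /=; lia.
pose t : i.-tuple 'I_d.+1 := [tuple inord (f s) | s < i].
have tE s : s < i -> nth 0 (map val t) s = f s.
  move=> si; rewrite (nth_map ord0) ?size_tuple //.
  by rewrite -[s]/(val (Ordinal si)) -tnth_nth tnth_mktuple /= inordK //; case: (fd s si).
exists t.
  apply/(sortedP 0) => s; rewrite size_map size_tuple => si.
  rewrite !tE ?(ltnW si) //; have [h1 _] := fd _ (ltnW si); have [h2 _] := fd _ si.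
  have := b2 _ si; rewrite /f.
  (* The shift changes only here, where the strict increase of [b] compensates for it. *)
  have [sj|sj] := eqVneq s.+1 j.-1; last by lia.
  by move: b3; rewrite (_ : j.-2 = s) -?sj; lia.
apply/ffunP => k; have pE l : v l = placement x (branch_seq t) i l.
  rewrite dec /placement; case: ifPn => // ln.
  have li : l - (n - i) < i by have := ltn_ord l; lia.
  apply: eq_walk li => s si; rewrite /branch_seq tE //; by case: (fd s si).
by rewrite !ffunE -!pE.
Qed.

(** The tuples are the multisets of size [i] in a set of d + 1 = d(x) - 2 elements. *)
Lemma card_tgt_id_at : #|[set c in tgt_id | low_end c == x]| = 'C(i + d, i).
Proof.
rewrite -card_sorted_tuples -(card_in_imset tuple_cell_inj).
apply: eq_card => c; rewrite in_set; apply/andP/imsetP => [[ct /eqP cx]|[t]].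
  by have [t ts ->] := tgt_id_tuple_cell ct cx; exists t; rewrite // in_set.
by rewrite in_set => /tuple_cell_tgt_id [h1 h2] ->; rewrite h2 eqxx.
Qed.

End FixedVertex.

Lemma card_tgt_id : #|tgt_id| = \sum_(2 <= l < i.+1) 'C(i - 2, l - 2) * mnum adj l.
Proof.
transitivity (\sum_(x : V | 2 < deg adj x) 'C(deg adj x - 1 + (i - 2), i)).
  rewrite -sum1_card (partition_big low_end (fun x => 2 < deg adj x)) /=; last first.
    by move=> c /tgt_idP [v [_ ce _ -> _]]; case: (crit_edge_deg ce).
  apply: eq_bigr => x dx.
  have [d dE] : exists d, deg adj x = d.+3 by exists (deg adj x - 3); lia.
  have := card_tgt_id_at dE; rewrite -sum1_card dE => h.
  rewrite (_ : d.+3 - 1 + (i - 2) = i + d) -?h; last by lia.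
  by apply: eq_bigl => c; rewrite in_set.
pose F x l := 'C(i - 2, l - 2) * 'C(deg adj x - 1, l).
rewrite (eq_big_nat _ _ (F2 := fun l => \sum_(x : V | 2 < deg adj x) F x l)); last first.
  move=> l /andP [l2 _]; rewrite /mnum big_distrr /= big_mkcond [RHS]big_mkcond /=.
  apply: eq_bigr => x _; rewrite /F; have [lx|xl] := ltnP l (deg adj x).
    by rewrite ifT //; apply: leq_ltn_trans lx.
  (* A vertex with 2 < deg <= l is absent from [mnum adj l], but its binomial coefficient vanishes
     anyway. *)
  by rewrite (@bin_small (deg adj x - 1) l) ?muln0 ?if_same //; lia.
rewrite exchange_big /=; apply: eq_bigr => x dx.
rewrite -Vandermonde -(big_mkord xpredT (fun l => 'C(deg adj x - 1, l) * 'C(i - 2, i - l))).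
(* The Vandermonde terms l = 0 and l = 1 vanish because i - l > i - 2. *)
rewrite big_ltn // big_ltn; last by lia.
rewrite !(@bin_small (i - 2)) ?muln0 ?add0n; try lia.
apply: eq_big_nat => l l_range; rewrite /F mulnC; congr (_ * _).
by rewrite -bin_sub; [congr 'C(_, _); lia | lia].
Qed.

End Count.

End Tree.

Theorem theorem4p5 (V : finType) (adj : rel V) (r : V)
    (num : V -> V -> nat) (n : nat) :
  is_tree adj -> deg adj r = 1 -> numbering_ok adj r num ->
  2 <= n -> suff_subdivided adj n -> (exists v, essential adj v) ->
  (* vertices of G(n,T): the critical 0-cells are exactly the cells whose
     coordinates are the vertices 0,...,n-1 in some order *)
  (forall a : ncell V n,
     crit0 adj r num a <->
     (inD adj a /\ (forall k, #|a k| = 1) /\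
      (forall v : 'I_n, exists k, tau_of adj r num a k = v))) /\
  #|[set a : ncell V n | crit0 adj r num a]| = n`! /\
  (* identification with S_n *)
  (forall tau : 'S_n, exists! a : ncell V n,
     crit0 adj r num a /\ forall k, tau_of adj r num a k = tau k) /\
  (* edges of G(n,T) *)
  exists E : nat -> nat -> {set ncell V n},
    (* disjoint union over 2 <= j <= i <= n *)
    (forall c : ncell V n, crit1 adj r num c <->
       exists i j, [/\ 2 <= j, j <= i, i <= n & c \in E i j]) /\
    (forall i j i' j' c, 2 <= j -> j <= i -> i <= n ->
       2 <= j' -> j' <= i' -> i' <= n ->
       c \in E i j -> c \in E i' j' -> i = i' /\ j = j') /\
    (forall i j, 2 <= j -> j <= i -> i <= n ->
       (* exactly sum_{l=2}^i C(i-2,l-2) m_l edges from each tau ... *)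
       (forall tau : 'S_n,
          #|[set c in E i j | [forall k, tau_of adj r num (gsrc adj r num c) k == tau k]]|
          = \sum_(2 <= l < i.+1) 'C(i - 2, l - 2) * mnum adj l) /\
       (* ... and every edge of E_{i,j} goes from tau to sigma_{i,j}^-1 o tau *)
       (forall c, c \in E i j -> forall k,
          cycnat n i j (tau_of adj r num (gtgt adj r num c) k)
          = tau_of adj r num (gsrc adj r num c) k) /\
       (* S_n-invariance and the action on oriented edges *)
       (forall c (mu : 'S_n), c \in E i j ->
          [/\ cact c mu \in E i j,
              forall k, tau_of adj r num (gsrc adj r num (cact c mu)) k
                        = tau_of adj r num (gsrc adj r num c) (mu k) &
              forall k, tau_of adj r num (gtgt adj r num (cact c mu)) k
                        = tau_of adj r num (gtgt adj r num c) (mu k)])).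

Proof.
move=> treeT degr numb n_gt1 subd ess.
split; first exact: crit0_surj.
split; first exact: card_crit0.
split; first exact: crit0_perm_uniq.
exists (edge_class adj r num n); split; first exact: crit1_edge_class.
split; first exact: edge_class_disjoint.
move=> i j j2 ji iN; split.
  move=> tau; rewrite -(card_tgt_id treeT numb degr n_gt1 subd ess j2 ji iN).
  rewrite -(card_src_tau treeT numb degr n_gt1 subd j2 ji iN tau).
  apply: eq_card => c; rewrite !in_set; congr (_ && _); apply: eq_forallb => k.
  by rewrite srcE.
split.
  move=> c cE k; have := edge_class_cycle treeT numb degr n_gt1 subd k j2 ji iN cE.
  by rewrite -srcE -tgtE.
move=> c mu cE; have [h1 h2 h3] := edge_class_cact treeT numb degr n_gt1 subd mu j2 ji iN cE.
split; first exact: h1.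
  by move=> k; have := h2 k; rewrite -!srcE.
by move=> k; have := h3 k; rewrite -!tgtE.
Qed.
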